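(* Let $(b_k)_{k\ge1}$ be i.i.d. real random variables with bounded support. Let $(\sigma_{k,N})_{1\le k\le N,\,N\ge1}$ be a uniformly bounded deterministic real triangular array such that, for some probability measure $\mu_T$ on $\mathbb R$ and $T\sim\mu_T$, $$\frac1{N-1}\sum_{k=1}^{N-1}\delta_{(\sigma_{k,N},\sigma_{k+1,N})}\Rightarrow\mathcal L(T,T)\qquad(N\to\infty).$$ Let $\widehat X_N$ be the $N\times N$ real symmetric tridiagonal matrix with zero diagonal and $\widehat X_N(k,k+1)=\widehat X_N(k+1,k)=b_k$ for $1\le k\le N-1$, and let $D_N:=\operatorname{diag}(\sigma_{1,N},\dots,\sigma_{N,N})$. Let $T\sim\mu_T$ and $X\sim\mu_b$ be independent real random variables. Then, for every noncommutative polynomial $P$ in two indeterminates, $$\operatorname{tr}_N P(D_N,\widehat X_N)\longrightarrow\mathbb E[P(T,X)]$$ in expectation and almost surely, where on the right the polynomial is evaluated at the commuting scalar variables $T$ and $X$. In particular, for all integers $r,q\ge0$, $$\operatorname{tr}_N(D_N^r\widehat X_N^q)\longrightarrow m_r(\mu_T)\,m_q(\mu_b)\qquad\text{almost surely}.$$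
   Context: $\operatorname{tr}_N=\frac1N\operatorname{Tr}$ is the normalized trace on $N\times N$ matrices; $m_q(\mu)=\int x^q\,d\mu(x)$; $\mathcal L(Y)$ is the law of $Y$; $\Rightarrow$ is weak convergence. The law $\mu_b$ is the limit law of the simple tridiagonal model with off-diagonal law that of $b_1$: the deterministic probability measure on $\mathbb R$ that is the almost sure weak limit of the empirical spectral distributions (normalized eigenvalue counting measures) of the matrices $\widehat X_N$. Equivalently, it is the probability measure whose Stieltjes transform $S_{\mu_b}(z)=\int\frac{d\mu_b(x)}{z-x}$ satisfies, for $\Im z>\sqrt{\mathbb E b_1^2}$, $S_{\mu_b}(z)=\mathbb E\left[\frac{1}{z-b_1^2S_1-b_2^2S_2}\right]$, where $b_1,b_2,S_1,S_2$ are independent and $S_1,S_2$ are distributed according to the unique law on the closed lower half-plane satisfying $S\stackrel d=\frac{1}{z-b^2S}$, with $b$ a copy of $b_1$ independent of $S$. *)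

(* Defs.v *)
From HB Require Import structures.
From mathcomp Require Import all_boot all_order all_algebra.
From mathcomp Require Import finmap monalg.
From mathcomp Require Import all_classical all_reals all_analysis.
From mathcomp Require Import complex polyrcf.

Set Implicit Arguments.
Unset Strict Implicit.
Unset Printing Implicit Defensive.

Import Order.TTheory GRing.Theory Num.Theory.
Import numFieldNormedType.Exports.

Local Open Scope classical_set_scope.
Local Open Scope ring_scope.
Local Open Scope complex_scope.

(* All indices are shifted to start at 0: [b k] is the paper's b_{k+1} and
   [sigma N k], for k < N, is the paper's sigma_{k+1,N}. *)

Section probability_notions.
Context (R : realType) (d : measure_display) (Omega : measurableType d)
  (P : probability Omega R).

Definition has_law (X : {RV P >-> R}) (mu : probability R R) : Prop :=
  forall A : set R, measurable A -> distribution P X A = mu A.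

Definition identically_distributed (b : nat -> {RV P >-> R}) : Prop :=
  forall k (A : set R), measurable A ->
    distribution P (b k) A = distribution P (b 0%N) A.

Definition mutually_independent (b : nat -> {RV P >-> R}) : Prop :=
  forall (s : seq nat) (A : nat -> set R), uniq s ->
    (forall k, measurable (A k)) ->
    P (\bigcap_(k in [set` s]) (b k @^-1` A k)) =
    (\prod_(k <- s) P (b k @^-1` A k))%E.

Definition independent_pair (X Y : {RV P >-> R}) : Prop :=
  forall A B : set R, measurable A -> measurable B ->
    P (X @^-1` A `&` Y @^-1` B) = (P (X @^-1` A) * P (Y @^-1` B))%E.

Definition pair_fun (X Y : {RV P >-> R}) (w : Omega) : R * R := (X w, Y w).

Lemma measurable_pair_fun (X Y : {RV P >-> R}) :
  measurable_fun setT (pair_fun X Y).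
Proof. by apply/measurable_fun_pairP; split; exact: measurable_funPT. Qed.

HB.instance Definition _ (X Y : {RV P >-> R}) :=
  isMeasurableFun.Build _ _ _ _ (pair_fun X Y) (measurable_pair_fun X Y).

Definition joint_law (X Y : {RV P >-> R}) : probability (R * R)%type R :=
  distribution P (pair_fun X Y).

Definition iid (b : nat -> {RV P >-> R}) : Prop :=
  mutually_independent b /\ identically_distributed b.

Definition bounded_support (X : {RV P >-> R}) : Prop :=
  exists M : R, distribution P X `[- M, M] = 1%E.

Definition expectationC (Z : Omega -> R[i]) : R[i] :=
  fine 'E_P[fun w => complex.Re (Z w)] +i* fine 'E_P[fun w => complex.Im (Z w)].

End probability_notions.

(* Convergence in the norm topology of R[i], which the library provides on the
   alias R[i]^o. *)
Definition cvgC (R : realType) (u : nat -> R[i]) (l : R[i]) : Prop :=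
  (u n : R[i]^o) @[n --> \oo] --> (l : R[i]^o).

Definition moment (R : realType) (q : nat) (mu : probability R R) : R :=
  (\int[mu]_x (x ^+ q))%R.

(* n^-1 (delta_{x 0} + ... + delta_{x (n-1)}); the zero measure for n = 0. *)
Definition empirical (R : realType) (d : measure_display)
    (E : measurableType d) (n : nat) (x : nat -> E) :
    {measure set E -> \bar R} :=
  mscale ((n%:R : R)^-1)%:nng (msum (fun k => \d_(x k)) n).

Definition weak_cvg (R : realType) (mu_ : nat -> {measure set R -> \bar R})
    (mu : {measure set R -> \bar R}) : Prop :=
  forall f : R -> R, continuous f -> (exists M, forall x, `|f x| <= M) ->
    (\int[mu_ n]_x f x)%R @[n --> \oo] --> (\int[mu]_x f x)%R.

Definition weak_cvg2 (R : realType)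
    (mu_ : nat -> {measure set (R * R) -> \bar R})
    (mu : {measure set (R * R) -> \bar R}) : Prop :=
  forall f : R * R -> R, continuous f -> (exists M, forall x, `|f x| <= M) ->
    (\int[mu_ n]_x f x)%R @[n --> \oo] --> (\int[mu]_x f x)%R.

Section matrices.
Context (R : realType).

Definition tridiag (N : nat) (b : nat -> R) : 'M[R]_N :=
  \matrix_(i, j) (if j == i.+1 :> nat then b i
                  else if i == j.+1 :> nat then b j else 0).

Definition diag_array (sigma : nat -> nat -> R) (N : nat) : 'M[R]_N :=
  diag_mx (\row_(k < N) sigma N k).

(* Normalized trace; equal to 0 for N = 0. *)
Definition ntr (K : fieldType) (N : nat) (A : 'M[K]_N) : K :=
  N%:R^-1 * \tr A.

(* Real eigenvalues with algebraic multiplicity, in increasing order; this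
   sequence has size N whenever A is symmetric. *)
Definition eigenvalues (N : nat) (A : 'M[R]_N) : seq R :=
  flatten [seq nseq (mup x (char_poly A)) x | x <- rootsR (char_poly A)].

Definition esd (N : nat) (A : 'M[R]_N) : {measure set R -> \bar R} :=
  empirical R N (nth 0 (eigenvalues A)).

(* mu is the almost sure weak limit of the empirical spectral distributions of
   the simple tridiagonal model built on b. *)
Definition tridiag_limit_law (d : measure_display) (Omega : measurableType d)
    (P : probability Omega R) (b : nat -> {RV P >-> R})
    (mu : probability R R) : Prop :=
  \forall w \ae P, weak_cvg (fun N => esd (tridiag N (fun k => b k w))) mu.

End matrices.

(* The free K-algebra on 'I_2: finitely supported families of coefficients
   indexed by words in two letters. *)
Definition ncpoly (K : nzRingType) : Type :=
  {malg K[{fmonom 'I_2}]}.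

(* Evaluation at letters a (index 0) and b (index 1), with coefficients sent
   to S by iota. *)
Definition nc_eval (K : nzRingType) (S : pzRingType) (iota : K -> S)
    (p : ncpoly K) (a b : S) : S :=
  \sum_(w <- msupp p)
    iota (p@_w) *
    \prod_(i <- fmonom_val w) (if i == ord0 then a else b).

Definition nc_eval_mx (R : realType) (N : nat) (p : ncpoly R[i])
    (A B : 'M[R]_N) : 'M[R[i]]_N :=
  nc_eval (fun c => c%:M) p (map_mx (real_complex R) A)
    (map_mx (real_complex R) B).

Definition nc_eval_scalar (R : realType) (p : ncpoly R[i]) (t x : R) : R[i] :=
  nc_eval id p t%:C x%:C.

(* Main.v *)
Require Import Defs.
From HB Require Import structures.
From mathcomp Require Import all_boot all_order all_algebra.
From mathcomp Require Import finmap monalg.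
From mathcomp Require Import all_classical all_reals all_analysis.
From mathcomp Require Import measurable_realfun.
From mathcomp Require Import complex polyrcf spectral.
From mathcomp Require Import zify ring lra.

Set Implicit Arguments.
Unset Strict Implicit.
Unset Printing Implicit Defensive.

Import Order.TTheory GRing.Theory Num.Theory.
Import numFieldNormedType.Exports.

Local Open Scope classical_set_scope.
Local Open Scope ring_scope.

(* The commutator of [D_N] and [X_N] has entries [b_k (sigma_k - sigma_{k+1})],
   whose normalized absolute sum tends to 0 because the limit of the pairs
   [(sigma_k, sigma_{k+1})] sits on the diagonal. Hence the letters of a word can
   be sorted, and only [tr_N (D_N ^ r X_N ^ q)], i.e. the weighted average of
   [sigma_k ^ r (X_N ^ q)_{kk}], matters. Away from the boundary [(X_N ^ q)_{kk}]
   is a fixed polynomial in [b_{k-q}, ..., b_{k+q-1}], so these variables are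
   stationary and finitely dependent; after splitting into residue classes the
   fourth moment of their centred weighted sums is [O(N ^ 2)], and the averages
   factor almost surely in the limit into [m_r(mu_T)] times the mean of
   [(X_N ^ q)_{kk}]. Taking [r = 0] and comparing with the spectral
   distribution identifies this mean with [m_q(mu_b)]. *)

(** * Means of bounded measurable functions, and factorization from superlevel sets *)

Section bounded_measurable.
Context (R : realType) (d : measure_display) (Omega : measurableType d)
  (P : probability Omega R).
Implicit Types f g : Omega -> R.

(** Three mismatches shape the development. The [b k] are bounded only almost surely, and weak
    convergence tests only bounded continuous functions, whereas powers are unbounded; truncation to
    an interval carrying the laws settles both, and the integrands become bounded and measurable.
    Independence is given on events only; it is carried over to powers by approximating one factor
    through indicators of its superlevel sets, without product measures. The weights
    [sigma N k ^+ r] change with [N], so the averages are not those of a single sequence and the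
    classical strong law does not apply; a fourth moment of order [N ^ 2] makes the fourth moments
    of the averages summable, whereas their variances, of order [1 / N], are not. The law [mu_b]
    enters only through its definition as a limit: two limits of one sequence are compared at a
    single sample point, and no formula for its moments is computed. *)

Definition bounded_mfun f : Prop :=
  measurable_fun setT f /\ exists K : R, forall w, `|f w| <= K.

Lemma bounded_mfun_cst (r : R) : bounded_mfun (fun=> r).
Proof. by split => //; exists `|r|. Qed.

Lemma bounded_mfunD f g :
  bounded_mfun f -> bounded_mfun g -> bounded_mfun (fun w => f w + g w).
Proof.
move=> [mf [K fK]] [mg [L gL]]; split; first exact: measurable_funD.
by exists (K + L) => w; rewrite (le_trans (ler_normD _ _))// lerD.
Qed.

Lemma bounded_mfunM f g :
  bounded_mfun f -> bounded_mfun g -> bounded_mfun (fun w => f w * g w).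
Proof.
move=> [mf [K fK]] [mg [L gL]]; split; first exact: measurable_funM.
by exists (K * L) => w; rewrite normrM ler_pM.
Qed.

Lemma bounded_mfunN f : bounded_mfun f -> bounded_mfun (fun w => - f w).
Proof.
move=> [mf [K fK]]; split; first exact: measurableT_comp.
by exists K => w; rewrite normrN.
Qed.

Lemma bounded_mfunB f g :
  bounded_mfun f -> bounded_mfun g -> bounded_mfun (fun w => f w - g w).
Proof. by move=> bf bg; apply: bounded_mfunD => //; exact: bounded_mfunN. Qed.

Lemma bounded_mfunX f n : bounded_mfun f -> bounded_mfun (fun w => f w ^+ n).
Proof.
move=> bf; elim: n => [|n IHn]; first exact: bounded_mfun_cst.
by under eq_fun do rewrite exprS; exact: bounded_mfunM.
Qed.

Lemma bounded_mfun_sum (I : Type) (s : seq I) (F : I -> Omega -> R) :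
  (forall i, bounded_mfun (F i)) -> bounded_mfun (fun w => \sum_(i <- s) F i w).
Proof.
move=> bF; elim: s => [|i s IHs].
  by under eq_fun do rewrite big_nil; exact: bounded_mfun_cst.
by under eq_fun do rewrite big_cons; exact: bounded_mfunD.
Qed.

Lemma bounded_mfun_prod (I : Type) (s : seq I) (F : I -> Omega -> R) :
  (forall i, bounded_mfun (F i)) -> bounded_mfun (fun w => \prod_(i <- s) F i w).
Proof.
move=> bF; elim: s => [|i s IHs].
  by under eq_fun do rewrite big_nil; exact: bounded_mfun_cst.
by under eq_fun do rewrite big_cons; exact: bounded_mfunM.
Qed.

Lemma bounded_mfun_indic (A : set Omega) :
  measurable A -> bounded_mfun (\1_A : Omega -> R).
Proof.
move=> mA; split; first exact: measurable_indic.
by exists 1 => w; rewrite indicE normr_nat lern1 leq_b1.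
Qed.

Lemma bounded_mfun_integrable f :
  bounded_mfun f -> P.-integrable setT (EFin \o f).
Proof.
move=> [mf [K fK]]; apply: measurable_bounded_integrable => //.
  by rewrite ltey_eq fin_num_measure.
exists K; split; first by rewrite num_real.
by move=> x Kx w _; rewrite /= (le_trans (fK w))// ltW.
Qed.

Lemma meanD f g : bounded_mfun f -> bounded_mfun g ->
  \int[P]_w (f w + g w) = \int[P]_w f w + \int[P]_w g w.
Proof. by move=> bf bg; apply: RintegralD => //; exact: bounded_mfun_integrable. Qed.

Lemma meanB f g : bounded_mfun f -> bounded_mfun g ->
  \int[P]_w (f w - g w) = \int[P]_w f w - \int[P]_w g w.
Proof. by move=> bf bg; apply: RintegralB => //; exact: bounded_mfun_integrable. Qed.

Lemma meanZ (r : R) f : bounded_mfun f ->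
  \int[P]_w (r * f w) = r * \int[P]_w f w.
Proof. by move=> bf; apply: RintegralZl => //; exact: bounded_mfun_integrable. Qed.

Lemma mean_cst (r : R) : \int[P]_w r = r.
Proof. by rewrite Rintegral_cst// [X in fine X](probability_setT P) mulr1. Qed.

Lemma mean_sum (I : Type) (s : seq I) (F : I -> Omega -> R) :
  (forall i, bounded_mfun (F i)) ->
  \int[P]_w (\sum_(i <- s) F i w) = \sum_(i <- s) \int[P]_w F i w.
Proof.
move=> bF; elim: s => [|i s IHs].
  by under eq_Rintegral do rewrite big_nil; rewrite big_nil mean_cst.
under eq_Rintegral do rewrite big_cons.
by rewrite meanD ?IHs ?big_cons//; exact: bounded_mfun_sum.
Qed.

Lemma le_mean f g : bounded_mfun f -> bounded_mfun g ->
  (forall w, f w <= g w) -> \int[P]_w f w <= \int[P]_w g w.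
Proof. by move=> bf bg fg; apply: le_Rintegral => //; exact: bounded_mfun_integrable. Qed.

Lemma mean_norm_le f K : bounded_mfun f -> (forall w, `|f w| <= K) ->
  `|\int[P]_w f w| <= K.
Proof.
move=> bf fK; rewrite ler_norml; apply/andP; split.
  rewrite -[leLHS]mean_cst; apply: le_mean => //; first exact: bounded_mfun_cst.
  by move=> w; move: (fK w); rewrite ler_norml => /andP[].
rewrite -[leRHS]mean_cst; apply: le_mean => //; first exact: bounded_mfun_cst.
by move=> w; move: (fK w); rewrite ler_norml => /andP[].
Qed.

Lemma mean_indic (A : set Omega) : measurable A ->
  \int[P]_w (\1_A w : R) = fine (P A).
Proof. by move=> mA; rewrite /Rintegral integral_indic// setIT. Qed.

(** Discrete layer-cake formula: the integer part counts the thresholds [k.+1] that [y] reaches. *)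
Lemma truncn_sum_indic (K : nat) (y : R) : 0 <= y <= K%:R ->
  (Num.truncn y)%:R = \sum_(0 <= k < K) (k.+1%:R <= y)%R%:R :> R.
Proof.
move=> /andP[y0 yK]; rewrite -natr_sum; congr _%:R.
have tK : (Num.truncn y <= K)%N.
  by rewrite -(ler_nat R) (le_trans _ yK)//; have /andP[] := truncn_itv y0.
rewrite (big_cat_nat _ tK)//= [X in (_ + X)%N]big_nat [X in (_ + X)%N]big1 ?addn0; last first.
  move=> k /andP[tk _]; apply/eqP; rewrite eqb0 -ltNge.
  by have /andP[_ /lt_le_trans->//] := truncn_itv y0; rewrite ler_nat.
rewrite big_nat (eq_bigr (fun=> 1%N)); first by rewrite -big_nat sum_nat_const_nat subn0 muln1.
move=> k /andP[_ kt]; apply/eqP; rewrite eqb1.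
by have /andP[+ _] := truncn_itv y0; apply: le_trans; rewrite ler_nat.
Qed.

(* [f] is approximated within [1 / n] by [truncn (n * f) / n], a finite
   combination of indicators of [t <= f]. *)
Lemma mean_prod_of_superlevels f g : bounded_mfun f -> bounded_mfun g ->
  (forall t, \int[P]_w ((t <= f w)%R%:R * g w) =
             \int[P]_w ((t <= f w)%R%:R) * \int[P]_w g w) ->
  \int[P]_w (f w * g w) = \int[P]_w f w * \int[P]_w g w.
Proof.
move=> bf bg.
(* Truncation is used on nonnegative values; adding the bound [K] to [f] changes both sides by [K]
   times the mean of [g]. *)
wlog f0 : f bf / forall w, 0 <= f w.
  move=> H fg; have [mf [K fK]] := bf.
  have bfK : bounded_mfun (fun w => f w + K).
    by apply: bounded_mfunD => //; exact: bounded_mfun_cst.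
  have H' : forall w, 0 <= f w + K.
    by move=> w; move: (fK w); rewrite ler_norml => /andP[+ _]; rewrite -subr_ge0 opprK.
  have /(H _ bfK H') : forall t : R, \int[P]_w ((t <= f w + K)%R%:R * g w) =
             \int[P]_w ((t <= f w + K)%R%:R) * \int[P]_w g w.
    move=> t; have := fg (t - K).
    by under eq_Rintegral do rewrite lerBlDr;
       under [in X in _ = X -> _]eq_Rintegral do rewrite lerBlDr.
  have bK := bounded_mfun_cst K.
  have -> : \int[P]_w ((f w + K) * g w) = \int[P]_w (f w * g w) + K * \int[P]_w g w.
    under eq_Rintegral do rewrite mulrDl.
    by rewrite meanD ?meanZ//; exact: bounded_mfunM.
  by rewrite meanD// mean_cst mulrDl => /addIr.
move=> fg; have [mf [K fK]] := bf; have [mg [L gL]] := bg.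
have mlev t : measurable [set w | t <= f w].
  have := mf measurableT `[t, +oo[%classic; rewrite setTI.
  have -> : f @^-1` `[t, +oo[ = [set w | t <= f w].
    by apply/seteqP; split => w /=; rewrite in_itv/= andbT.
  by apply.
have blev t : bounded_mfun (fun w => (t <= f w)%R%:R).
  have -> : (fun w => (t <= f w)%R%:R) = (\1_[set w | t <= f w] : Omega -> R).
    apply/funext => w; rewrite indicE; congr (nat_of_bool _)%:R.
    by apply/idP/idP => [h|/set_mem//]; exact/mem_set.
  exact: bounded_mfun_indic.
have L0 : 0 <= L by rewrite (le_trans _ (gL point)).
have K0 : 0 <= K by rewrite (le_trans _ (fK point)).
(* The absolute covariance times any [n.+1] stays below [2 * L], so it vanishes by the Archimedean
   property. *)
suff H n : n.+1%:R * `|\int[P]_w (f w * g w) - \int[P]_w f w * \int[P]_w g w| <= 2 * L.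
  apply/eqP; rewrite -subr_eq0; apply/negPn/negP; rewrite -normr_gt0.
  move: H; set D := `| _ - _ | => H D0; have := H (Num.truncn (2 * L / D)).
  apply/negP; rewrite -ltNge -ltr_pdivrMr//.
  have /truncn_itv/andP[_] : 0 <= 2 * L / D by rewrite divr_ge0 ?mulr_ge0 ?(ltW D0).
  by [].
set m := (Num.truncn (n.+1%:R * K)).+1.
have h0 w : 0 <= n.+1%:R * f w <= m%:R.
  rewrite mulr_ge0//=.
  have /truncn_itv/andP[_ /ltW] : 0 <= n.+1%:R * K by rewrite mulr_ge0.
  apply: le_trans; rewrite ler_pM2l// (le_trans _ (fK w))// ler_norm//.
pose h w : R := (Num.truncn (n.+1%:R * f w))%:R.
have hE w : h w = \sum_(0 <= k < m) (k.+1%:R / n.+1%:R <= f w)%R%:R.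
  rewrite /h (truncn_sum_indic (h0 w)); apply: eq_bigr => k _.
  by rewrite ler_pdivrMr// mulrC.
have bh : bounded_mfun h.
  by rewrite (funext hE); apply: bounded_mfun_sum => k.
have hg : \int[P]_w (h w * g w) = \int[P]_w h w * \int[P]_w g w.
  under eq_Rintegral do rewrite hE mulr_suml.
  rewrite mean_sum; last by move=> k; exact: bounded_mfunM.
  under eq_bigr do rewrite fg.
  rewrite -mulr_suml -mean_sum//; congr (_ * _).
  by apply: eq_Rintegral => w _; rewrite hE.
(* [e] is the fractional part of [n.+1%:R * f w]. Since the mean of [h * g] factors, the scaled
   covariance of [f] and [g] is that of [e] and [g], at most [L + L]. *)
pose e w := n.+1%:R * f w - h w.
have eb w : `|e w| <= 1.
  rewrite /e /h; have /andP[/truncn_itv/andP[h1 h2] _] := h0 w.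
  by rewrite ger0_norm ?subr_ge0// lerBlDr addrC natr1 ltW.
have bnf : bounded_mfun (fun w => n.+1%:R * f w).
  by apply: bounded_mfunM => //; exact: bounded_mfun_cst.
have be : bounded_mfun e by exact: bounded_mfunB.
have -> : n.+1%:R * `|\int[P]_w (f w * g w) - \int[P]_w f w * \int[P]_w g w| =
    `|\int[P]_w (e w * g w) - \int[P]_w e w * \int[P]_w g w|.
  rewrite -[X in X * _]ger0_norm// -normrM; congr `|_|.
  under [in RHS]eq_Rintegral do rewrite /e mulrBl -mulrA.
  rewrite [in RHS]meanB//; last first.
  - exact: bounded_mfunM.
  - by apply: bounded_mfunM => //; [exact: bounded_mfun_cst|exact: bounded_mfunM].
  rewrite [in RHS]meanB// hg !meanZ//; last exact: bounded_mfunM.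
  by ring.
rewrite (le_trans (ler_normB _ _))// mulrDl mul1r lerD//.
  apply: mean_norm_le => [|w]; first exact: bounded_mfunM.
  by rewrite normrM -[leRHS]mul1r ler_pM.
rewrite normrM -[leRHS]mul1r ler_pM//; exact: mean_norm_le.
Qed.

End bounded_measurable.

(** * Means of polynomials in independent bounded variables *)

Section independent_products.
Context (R : realType) (d : measure_display) (Omega : measurableType d)
  (P : probability Omega R).
Variables (c : nat -> Omega -> R).
Hypothesis c_bounded : forall k, bounded_mfun (c k).
Hypothesis c_indep : forall (s : seq nat) (A : nat -> set R), uniq s ->
  (forall k, measurable (A k)) ->
  P (\bigcap_(k in [set` s]) (c k @^-1` A k)) =
  (\prod_(k <- s) P (c k @^-1` A k))%E.

Let c_measurable k (A : set R) : measurable A -> measurable (c k @^-1` A).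
Proof. by move=> mA; have [mc _] := c_bounded k; rewrite -[_ @^-1` _]setTI; exact: mc. Qed.

Lemma mean_prod_indic (s : seq nat) (A : nat -> set R) : uniq s ->
  (forall k, measurable (A k)) ->
  \int[P]_w (\prod_(k <- s) \1_(c k @^-1` A k) w) =
  \prod_(k <- s) \int[P]_w (\1_(c k @^-1` A k) w : R).
Proof.
move=> us mA.
have -> : (fun w => \prod_(k <- s) \1_(c k @^-1` A k) w) =
    (\1_(\bigcap_(k in [set` s]) (c k @^-1` A k)) : Omega -> R).
  apply/funext => w; rewrite bigcap_seq; elim: s {us} => [|k s IHs].
    by rewrite !big_nil indicT.
  by rewrite !big_cons IHs indicI.
rewrite mean_indic; last first.
  by rewrite bigcap_seq; apply: bigsetI_measurable => k _; exact: c_measurable.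
rewrite c_indep//; elim: s {us} => [|k s IHs]; first by rewrite !big_nil.
rewrite !big_cons mean_indic ?fineM ?IHs//; last exact: c_measurable.
- by rewrite fin_num_measure//; exact: c_measurable.
- elim: s {IHs} => [|j s IHs]; rewrite ?big_nil// big_cons fin_numM//.
  by rewrite fin_num_measure//; exact: c_measurable.
Qed.

(* Indicators are replaced by powers one index at a time. *)
Lemma mean_prod_powers_indic (e : nat -> nat) (s t : seq nat) (A : nat -> set R) :
  uniq (s ++ t) -> (forall k, measurable (A k)) ->
  \int[P]_w (\prod_(k <- s) c k w ^+ e k * \prod_(k <- t) \1_(c k @^-1` A k) w) =
  (\prod_(k <- s) \int[P]_w (c k w ^+ e k)) *
  \prod_(k <- t) \int[P]_w (\1_(c k @^-1` A k) w : R).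
Proof.
elim: s t A => [|i s IHs] t A.
  move=> ut mA; under eq_Rintegral do rewrite big_nil mul1r.
  by rewrite big_nil mul1r; exact: mean_prod_indic.
move=> /= /andP[ist ust] mA.
pose W w := \prod_(k <- s) c k w ^+ e k * \prod_(k <- t) \1_(c k @^-1` A k) w.
have bind k (B : set R) : measurable B ->
    bounded_mfun (\1_(c k @^-1` B) : Omega -> R).
  by move=> mB; apply: bounded_mfun_indic; exact: c_measurable.
have bpow k : bounded_mfun (fun w => c k w ^+ e k) by exact: bounded_mfunX.
have bW : bounded_mfun W.
  by apply: bounded_mfunM; apply: bounded_mfun_prod => k//; exact: bind.
transitivity (\int[P]_w (c i w ^+ e i * W w)).
  by apply: eq_Rintegral => w _; rewrite big_cons mulrA.
(* The new power is reduced to its superlevel sets, which turns [i] into one more indicator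
   index. *)
rewrite mean_prod_of_superlevels//; first by rewrite /W IHs// big_cons mulrA.
move=> r; pose B := [set x : R | r <= x ^+ e i].
have mB : measurable B.
  have := @exprn_measurable R setT (e i) measurableT `[r, +oo[%classic.
  rewrite setTI; have -> : (fun x : R => x ^+ e i) @^-1` `[r, +oo[ = B.
    by apply/seteqP; split => x /=; rewrite in_itv/= andbT.
  by apply.
have BE w : (r <= c i w ^+ e i)%R%:R = \1_(c i @^-1` B) w :> R.
  rewrite indicE; congr (nat_of_bool _)%:R.
  by apply/idP/idP => [h|/set_mem//]; exact/mem_set.
(* [i] does not occur in [t], so redefining [A] at [i] leaves the other indicators unchanged. *)
pose A' k := if k == i then B else A k.
have mA' k : measurable (A' k) by rewrite /A'; case: ifP.
have A'E k : k \in t -> A' k = A k.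
  move=> kt; rewrite /A'; case: eqP => // ki; move: ist.
  by rewrite -ki mem_cat kt orbT.
have ust' : uniq (s ++ i :: t).
  by rewrite -cat1s (perm_uniq (permEl (perm_catCA s [:: i] t)))/= ist.
transitivity (\int[P]_w (\prod_(k <- s) c k w ^+ e k *
    \prod_(k <- i :: t) \1_(c k @^-1` A' k) w)).
  apply: eq_Rintegral => w _; rewrite BE big_cons /A' eqxx mulrCA; congr (_ * _).
  by congr (_ * _); apply: eq_big_seq => k kt; rewrite -/(A' k) A'E.
rewrite IHs// big_cons mulrCA {1}/A' eqxx /W IHs//.
congr (_ * (_ * _)); first by apply: eq_Rintegral => w _; rewrite BE.
by apply: eq_big_seq => k kt; rewrite A'E.
Qed.

Lemma mean_prod_powers (e : nat -> nat) (s : seq nat) : uniq s ->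
  \int[P]_w (\prod_(k <- s) c k w ^+ e k) =
  \prod_(k <- s) \int[P]_w (c k w ^+ e k).
Proof.
move=> us; have := @mean_prod_powers_indic e s [::] (fun=> setT).
rewrite cats0 big_nil mulr1 => <-//.
by apply: eq_Rintegral => w _; rewrite big_nil mulr1.
Qed.

(** Repetitions in [l] are allowed; the multiplicity of an index is its exponent. *)
Definition monomial (l : seq nat) (w : Omega) : R := \prod_(k <- l) c k w.

Lemma bounded_mfun_monomial l : bounded_mfun (monomial l).
Proof. exact: bounded_mfun_prod. Qed.

Lemma mean_monomial (l : seq nat) :
  \int[P]_w monomial l w =
  \prod_(k <- undup l) \int[P]_w (c k w ^+ count_mem k l).
Proof.
rewrite -mean_prod_powers ?undup_uniq//.
apply: eq_Rintegral => w _; rewrite /monomial.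
(* A power is by definition an iterated product, so grouping equal factors gives the exponents. *)
by rewrite -[LHS]big_undup_iterop_count.
Qed.

Lemma mean_monomial_cat (l1 l2 : seq nat) : ~~ has (mem l1) l2 ->
  \int[P]_w (monomial l1 w * monomial l2 w) =
  \int[P]_w monomial l1 w * \int[P]_w monomial l2 w.
Proof.
move=> l12; have -> : (fun w => monomial l1 w * monomial l2 w) = monomial (l1 ++ l2).
  by apply/funext => w; rewrite /monomial big_cat.
have dis k : k \in l1 -> k \in l2 -> False.
  by move=> k1 k2; move/negP: l12; apply; apply/hasP; exists k.
rewrite !mean_monomial undup_cat big_cat/=; congr (_ * _).
- rewrite (_ : [seq x <- undup l1 | x \notin l2] = undup l1).
    apply: eq_big_seq => k; rewrite mem_undup => k1; rewrite count_cat.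
    by rewrite (_ : count_mem k l2 = 0%N) ?addn0//; apply/count_memPn/negP; exact: dis.
  by apply/all_filterP/allP => k; rewrite mem_undup => k1; apply/negP; exact: dis.
- apply: eq_big_seq => k; rewrite mem_undup => k2; rewrite count_cat.
  rewrite (_ : count_mem k l1 = 0%N) ?add0n//.
  by apply/count_memPn/negP => k1; exact: (dis k).
Qed.

(** A translation is injective, hence preserves multiplicities, and the mean depends only on these
    and on the common moments. *)
Lemma mean_monomial_shift (l : seq nat) (m : nat) :
  (forall k n, \int[P]_w (c k w ^+ n) = \int[P]_w (c 0 w ^+ n)) ->
  \int[P]_w monomial [seq (m + k)%N | k <- l] w = \int[P]_w monomial l w.
Proof.
move=> idd; rewrite !mean_monomial undup_map_inj; last exact: addnI.
rewrite big_map; apply: eq_bigr => k _; rewrite idd [RHS]idd.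
rewrite count_map; apply: eq_Rintegral => w _; congr (_ ^+ _).
by apply: eq_count => j /=; rewrite eqn_add2l.
Qed.

(** A syntactic stand-in for measurability with respect to the variables indexed by [I]: it is
    stable under sums, products and powers, and disjoint index sets give factorization of means. *)
Definition poly_in (I : pred nat) (f : Omega -> R) : Prop :=
  exists2 L : seq (R * seq nat), all (fun x => all I x.2) L &
    f = fun w => \sum_(x <- L) x.1 * monomial x.2 w.

Lemma poly_in_bounded I f : poly_in I f -> bounded_mfun f.
Proof.
move=> [L _ ->]; apply: bounded_mfun_sum => x; apply: bounded_mfunM.
  exact: bounded_mfun_cst.
exact: bounded_mfun_monomial.
Qed.

Lemma poly_in_sub (I J : pred nat) f : subpred I J -> poly_in I f -> poly_in J f.
Proof.
move=> IJ [L LI ->]; exists L => //; apply: sub_all LI => x; exact: sub_all.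
Qed.

Lemma poly_in_cst I r : poly_in I (fun=> r).
Proof.
exists [:: (r, [::])] => //; apply/funext => w.
by rewrite big_seq1 /= /monomial big_nil mulr1.
Qed.

Lemma poly_inD I f g : poly_in I f -> poly_in I g -> poly_in I (fun w => f w + g w).
Proof.
move=> [L LI ->] [K KI ->]; exists (L ++ K); first by rewrite all_cat LI.
by apply/funext => w; rewrite big_cat.
Qed.

Lemma poly_inM I f g : poly_in I f -> poly_in I g -> poly_in I (fun w => f w * g w).
Proof.
move=> [L LI ->] [K KI ->].
exists [seq (x.1 * y.1, x.2 ++ y.2) | x <- L, y <- K].
  apply/allP => _ /allpairsP[[x y] /= [xL yK ->]] /=.
  by rewrite all_cat (allP LI)// (allP KI).
apply/funext => w; rewrite big_allpairs_dep mulr_suml; apply: eq_bigr => x _.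
rewrite mulr_sumr; apply: eq_bigr => y _ /=.
by rewrite /monomial big_cat mulrACA.
Qed.

Lemma poly_inX I f n : poly_in I f -> poly_in I (fun w => f w ^+ n).
Proof.
move=> If; elim: n => [|n IHn]; first exact: poly_in_cst.
by under eq_fun do rewrite exprS; exact: poly_inM.
Qed.

Lemma poly_in_sum I (J : eqType) (s : seq J) (F : J -> Omega -> R) :
  (forall j, j \in s -> poly_in I (F j)) -> poly_in I (fun w => \sum_(j <- s) F j w).
Proof.
elim: s => [_|j s IHs Fs].
  by under eq_fun do rewrite big_nil; exact: poly_in_cst.
under eq_fun do rewrite big_cons; apply: poly_inD; first by apply: Fs; rewrite mem_head.
by apply: IHs => i si; apply: Fs; rewrite in_cons si orbT.
Qed.

(** Bilinearity reduces the claim to two monomials without a common index. *)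
Lemma mean_poly_inM (I J : pred nat) f g : (forall k, I k -> J k -> False) ->
  poly_in I f -> poly_in J g ->
  \int[P]_w (f w * g w) = \int[P]_w f w * \int[P]_w g w.
Proof.
move=> IJ [L LI ->] [K KJ ->].
have bm (x : R * seq nat) : bounded_mfun (fun w => x.1 * monomial x.2 w).
  by apply: bounded_mfunM; [exact: bounded_mfun_cst|exact: bounded_mfun_monomial].
under eq_Rintegral do rewrite mulr_suml.
rewrite mean_sum; last first.
  by move=> x; apply: bounded_mfunM => //; exact: bounded_mfun_sum.
rewrite mean_sum// mulr_suml; apply: eq_big_seq => x xL.
under eq_Rintegral do rewrite mulr_sumr.
rewrite mean_sum; last by move=> y; exact: bounded_mfunM.
rewrite mean_sum// mulr_sumr; apply: eq_big_seq => y yK.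
under eq_Rintegral do rewrite mulrACA.
rewrite !meanZ ?mean_monomial_cat//; do ?exact: bounded_mfun_monomial.
- by rewrite mulrACA.
- apply/hasPn => k ky; apply/negP => kx.
  by apply: (IJ k); [exact: (allP (allP LI _ xL))|exact: (allP (allP KJ _ yK))].
- by apply: bounded_mfunM; exact: bounded_mfun_monomial.
Qed.

End independent_products.

(** * Fourth moments of centred sums and almost sure convergence *)

Section fourth_moment.
Context (R : realType) (d : measure_display) (Omega : measurableType d)
  (P : probability Omega R).

(** In the expansion of [(S + Z) ^+ 4] the terms with [S ^+ 3 * Z] and [S * Z ^+ 3] have mean 0,
    since [S] and [Z] are centred. The second moment of [S] being at most [n K ^ 2], a step adds at
    most [(6 n + 1) K ^ 4], which fits into [3 (n + 1) ^ 2 - 3 n ^ 2] times [K ^ 4]. *)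
Lemma fourth_moment_sum (Z : nat -> Omega -> R) (K : R) (n : nat) :
  let S t w := \sum_(s < t) Z s w in
  (forall t, bounded_mfun (Z t)) -> (forall t w, `|Z t w| <= K) ->
  (forall t, \int[P]_w Z t w = 0) ->
  (forall t i j, \int[P]_w (S t w ^+ i * Z t w ^+ j) =
                 \int[P]_w (S t w ^+ i) * \int[P]_w (Z t w ^+ j)) ->
  \int[P]_w (S n w ^+ 4) <= 3 * n%:R ^+ 2 * K ^+ 4.
Proof.
move=> S bZ ZK Z0 SZ.
have bS t : bounded_mfun (S t) by apply: bounded_mfun_sum => s.
have bX f j : bounded_mfun f -> bounded_mfun (fun w => f w ^+ j).
  exact: bounded_mfunX.
have bSZ t i j : bounded_mfun (fun w => S t w ^+ i * Z t w ^+ j).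
  by apply: bounded_mfunM; exact: bX.
have bC r f : bounded_mfun f -> bounded_mfun (fun w => r * f w).
  by move=> bf; apply: bounded_mfunM => //; exact: bounded_mfun_cst.
have ZjK t j : \int[P]_w (Z t w ^+ j) <= K ^+ j.
  rewrite (le_trans (ler_norm _))//; apply: mean_norm_le => [|w]; first exact: bX.
  by rewrite normrX lerXn2r// ?nnegrE// (le_trans _ (ZK t w)).
have S1 t : \int[P]_w S t w = 0.
  by rewrite /S mean_sum// big1.
have Ssplit t w : S t.+1 w = S t w + Z t w by rewrite /S big_ord_recr.
have K0 : 0 <= K by rewrite (le_trans _ (ZK 0 point)).
have S2 t : \int[P]_w (S t w ^+ 2) <= t%:R * K ^+ 2.
  elim: t => [|t IHt].
    under eq_Rintegral do rewrite /S big_ord0 expr0n/=.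
    by rewrite mean_cst mul0r.
  have E w : S t.+1 w ^+ 2 =
      S t w ^+ 2 + 2 * (S t w ^+ 1 * Z t w ^+ 1) + Z t w ^+ 2.
    by rewrite Ssplit; ring.
  under eq_Rintegral do rewrite E.
  rewrite meanD; [|apply: bounded_mfunD; [exact: bX|exact: bC]|exact: bX].
  rewrite meanD; [|exact: bX|exact: bC].
  rewrite meanZ// SZ; under [X in _ + 2 * (_ * X)]eq_Rintegral do rewrite expr1.
  rewrite Z0 !mulr0 addr0 -natr1 mulrDl mul1r lerD//.
elim: n => [|n IHn].
  under eq_Rintegral do rewrite /S big_ord0 expr0n/=.
  by rewrite mean_cst expr0n/= mulr0 mul0r.
have E w : S n.+1 w ^+ 4 =
    S n w ^+ 4 + 4 * (S n w ^+ 3 * Z n w ^+ 1) + 6 * (S n w ^+ 2 * Z n w ^+ 2)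
    + 4 * (S n w ^+ 1 * Z n w ^+ 3) + Z n w ^+ 4.
  by rewrite Ssplit; ring.
under eq_Rintegral do rewrite E.
have b1 : bounded_mfun (fun w => S n w ^+ 4) by exact: bX.
have b2 : bounded_mfun (fun w => 4 * (S n w ^+ 3 * Z n w ^+ 1)) by exact: bC.
have b3 : bounded_mfun (fun w => 6 * (S n w ^+ 2 * Z n w ^+ 2)) by exact: bC.
have b4 : bounded_mfun (fun w => 4 * (S n w ^+ 1 * Z n w ^+ 3)) by exact: bC.
have b5 : bounded_mfun (fun w => Z n w ^+ 4) by exact: bX.
have b12 := bounded_mfunD b1 b2; have b123 := bounded_mfunD b12 b3.
have b1234 := bounded_mfunD b123 b4.
rewrite !meanD// !meanZ// !SZ.
have -> : \int[P]_w (Z n w ^+ 1) = 0.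
  by under eq_Rintegral do rewrite expr1.
have -> : \int[P]_w (S n w ^+ 1) = 0.
  by under eq_Rintegral do rewrite expr1.
rewrite mulr0 mul0r !mulr0 !addr0.
have H2 : \int[P]_w (S n w ^+ 2) * \int[P]_w (Z n w ^+ 2) <= n%:R * K ^+ 2 * K ^+ 2.
  by apply: ler_pM => //; apply: Rintegral_ge0 => w _; exact: sqr_ge0.
have := ZjK n 4; have : 0 <= K ^+ 4 by exact: exprn_ge0.
move: IHn H2; rewrite -[n.+1%:R]natr1.
have -> : n%:R * K ^+ 2 * K ^+ 2 = n%:R * K ^+ 4 by ring.
have -> : 3 * (n%:R + 1) ^+ 2 * K ^+ 4 =
   3 * n%:R ^+ 2 * K ^+ 4 + 6 * (n%:R * K ^+ 4) + 3 * K ^+ 4 by ring.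
lra.
Qed.

(** Telescoping: [1 / (k + 1) ^ 2] is at most [2 / (k + 1) - 2 / (k + 2)], because
    [k + 2 <= 2 (k + 1)]. *)
Lemma sum_inv_square_le n : \sum_(0 <= k < n) (k.+1%:R ^+ 2)^-1 <= 2 :> R.
Proof.
suff : \sum_(0 <= k < n) (k.+1%:R ^+ 2)^-1 <= 2 - 2 / n.+1%:R :> R.
  by move=> /le_trans; apply; rewrite lerBlDr lerDl divr_ge0.
elim: n => [|n IHn]; first by rewrite big_nil divr1 subrr.
rewrite big_nat_recr//= (le_trans (lerD IHn (lexx _)))//.
rewrite -[n.+2%:R]natr1; set x : R := n.+1%:R.
have x1 : 1 <= x by rewrite ler1n.
rewrite -subr_ge0 (_ : _ - _ = (x - 1) / (x ^+ 2 * (x + 1))).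
  by rewrite divr_ge0 ?subr_ge0// mulr_ge0 ?exprn_ge0; lra.
by field; rewrite !gt_eqF//; lra.
Qed.

(** The means of [(S n / n) ^+ 4] are at most [C / n ^ 2], so by monotone convergence the series of
    these variables has finite mean. It therefore converges almost surely, and its terms tend to
    0. *)
Lemma as_cvg_of_fourth_moment (S : nat -> Omega -> R) (C : R) :
  (forall n, bounded_mfun (S n)) ->
  (forall n, \int[P]_w (S n w ^+ 4) <= C * n%:R ^+ 2) ->
  \forall w \ae P, S n w / n%:R @[n --> \oo] --> (0 : R).
Proof.
move=> bS SC.
(* The index starts at 1, away from the division by 0. *)
pose u n w := (S n.+1 w / n.+1%:R) ^+ 4.
have u0 n w : 0 <= u n w by rewrite /u -[4%N]/(2 * 2)%N exprM sqr_ge0.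
have bu n : bounded_mfun (u n).
  apply: bounded_mfunX; apply: bounded_mfunM => //; exact: bounded_mfun_cst.
have mu_ n : measurable_fun setT (fun w => (u n w)%:E).
  by apply/measurable_EFinP; have [] := bu n.
have Eu n : \int[P]_w u n w <= C * (n.+1%:R ^+ 2)^-1.
  rewrite (_ : \int[P]_w u n w = (n.+1%:R ^+ 4)^-1 * \int[P]_w (S n.+1 w ^+ 4)).
    rewrite -ler_pdivlMl ?invr_gt0 ?exprn_gt0// invrK mulrCA (le_trans (SC _))//.
    by rewrite -[4%N]/(2 + 2)%N exprD mulfK// expf_neq0// pnatr_eq0.
  rewrite -meanZ; last exact: bounded_mfunX.
  by apply: eq_Rintegral => w _; rewrite /u expr_div_n mulrC.
pose g w := (\sum_(0 <= n <oo) (u n w)%:E)%E.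
have g0 w : (0 <= g w)%E by apply: nneseries_ge0 => n _ _; rewrite lee_fin.
have mg : measurable_fun setT g.
  by apply: ge0_emeasurable_sum => // n w _ _; rewrite lee_fin.
have gfin : (\int[P]_w g w < +oo)%E.
  rewrite /g integral_nneseries//; last by move=> n w _; rewrite lee_fin.
  apply: (@le_lt_trans _ _ (C * 2)%:E); last exact: ltry.
  apply: lime_le; first by apply: is_cvg_nneseries => n _ _; apply: integral_ge0 => w _; rewrite lee_fin.
  apply: nearW => n.
  have EE k : (\int[P]_w (u k w)%:E)%E = (\int[P]_w u k w)%:E.
    by rewrite /Rintegral fineK//; apply: integrable_fin_num => //; exact: bounded_mfun_integrable.
  under eq_bigr do rewrite EE.
  rewrite sumEFin lee_fin (le_trans (ler_sum _ (fun k _ => Eu k)))//.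
  rewrite -mulr_sumr ler_wpM2l ?sum_inv_square_le//.
  (* The bound at index 0 shows that [C] is nonnegative. *)
  have := Eu 0; rewrite expr1n invr1 mulr1; apply: le_trans.
  by apply: Rintegral_ge0 => w _.
have gi : P.-integrable setT g.
  apply/integrableP; split => //.
  by under eq_integral do rewrite gee0_abs//.
have := integrable_ae measurableT gi; apply: filterS => w /(_ I) gw.
have us : cvgn (series (fun n => u n w)).
  apply: nondecreasing_is_cvgn.
    by apply/nondecreasing_seqP => n; rewrite seriesSr lerDl.
  exists (fine (g w)) => _ [n _ <-].
  rewrite -lee_fin fineK// /series/= -sumEFin; apply: nneseries_lim_ge => k _ _.
  by rewrite lee_fin.
have /cvgrPdist_lt uc := cvg_series_cvg_0 us.
rewrite -cvg_shiftS; apply/cvgrPdist_lt => e e0.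
have e40 : 0 < e ^+ 4 by exact: exprn_gt0.
have := uc _ e40; apply: filterS => n.
rewrite !sub0r !normrN /u normrX => h.
by rewrite ltNge; apply/negP => /(@lerXn2r _ 4 _ _); rewrite !nnegrE => /(_ (ltW e0) (normr_ge0 _)); rewrite leNgt h.
Qed.

End fourth_moment.

(** * Weighted strong law for a stationary, finitely dependent sequence *)

Lemma cvgn_sum (K : numFieldType) (V : normedModType K) (I : Type) (s : seq I)
    (u : I -> nat -> V) (l : I -> V) :
  (forall i, u i n @[n --> \oo] --> l i) ->
  \sum_(i <- s) u i n @[n --> \oo] --> \sum_(i <- s) l i.
Proof.
move=> ul; elim: s => [|i s IHs].
  by under eq_fun do rewrite big_nil; rewrite big_nil; exact: cvg_cst.
by under eq_fun do rewrite big_cons; rewrite big_cons; exact: cvgD.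
Qed.

Section weighted_law_of_large_numbers.
Context (R : realType) (d : measure_display) (Omega : measurableType d)
  (P : probability Omega R).
Variables (c : nat -> Omega -> R) (M : R).
Hypothesis c_measurable : forall k, measurable_fun setT (c k).
Hypothesis c_le : forall k w, `|c k w| <= M.
Hypothesis c_indep : forall (s : seq nat) (A : nat -> set R), uniq s ->
  (forall k, measurable (A k)) ->
  P (\bigcap_(k in [set` s]) (c k @^-1` A k)) =
  (\prod_(k <- s) P (c k @^-1` A k))%E.
Hypothesis c_moments : forall k n,
  \int[P]_w (c k w ^+ n) = \int[P]_w (c 0 w ^+ n).

Let c_bounded k : bounded_mfun (c k).
Proof. by split => //; exists M. Qed.

(** [L] lists the monomials, with unit coefficients, of a fixed polynomial; it is read on the
    variables from index [k] on, so that varying [k] gives a stationary sequence. *)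
Definition local_poly (L : seq (seq nat)) (k : nat) (w : Omega) : R :=
  \sum_(l <- L) monomial c [seq (k + i)%N | i <- l] w.

Lemma local_poly_le L k w :
  `|local_poly L k w| <= \sum_(l <- L) M ^+ size l.
Proof.
rewrite (le_trans (ler_norm_sum _ _ _))//; apply: ler_sum => l _.
rewrite /monomial big_map normr_prod.
have M0 : 0 <= M by rewrite (le_trans _ (c_le 0 point)).
elim: l => [|i l IHl]; rewrite ?big_nil// big_cons/= exprS.
by apply: ler_pM => //; exact: prodr_ge0.
Qed.

Lemma local_poly_in L m k : all (all (fun i => i < m)%N) L ->
  poly_in c (fun i => k <= i < k + m)%N (local_poly L k).
Proof.
move=> Lm; apply: poly_in_sum => l lL.
exists [:: (1, [seq (k + i)%N | i <- l])].
  rewrite /= andbT; apply/allP => _ /mapP[i il ->].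
  by have := allP (allP Lm _ lL) _ il; lia.
by apply/funext => w; rewrite big_seq1 mul1r.
Qed.

Lemma mean_local_poly L k :
  \int[P]_w local_poly L k w = \int[P]_w local_poly L 0 w.
Proof.
rewrite !mean_sum; do ?by move=> l; exact: bounded_mfun_monomial.
by apply: eq_bigr => l _; rewrite !(mean_monomial_shift c_bounded c_indep).
Qed.

Lemma big_nat_blocks (F : nat -> R) (N m : nat) :
  \sum_(0 <= k < N * m) F k = \sum_(j < m) \sum_(t < N) F (t * m + j)%N.
Proof.
elim: N => [|N IHN].
  by rewrite big_geq// big1// => j _; rewrite big_ord0.
rewrite (big_cat_nat (n := (N * m)%N))//=; last by rewrite leq_mul2r leqnSn orbT.
under [RHS]eq_bigr do rewrite big_ord_recr/=.
rewrite big_split/= IHN; congr (_ + _).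
rewrite -{1}[(N * m)%N]add0n big_addn mulSn addnK big_mkord.
by apply: eq_bigr => j _; rewrite addnC.
Qed.

(* Along a residue class mod [m] the summands are independent, so each class
   has a fourth moment of order [N ^ 2]. *)
Lemma weighted_lln (L : seq (seq nat)) (m : nat) (a : nat -> nat -> R) (A : R) :
  all (all (fun i => i < m)%N) L -> (forall N k, `|a N k| <= A) ->
  \forall w \ae P,
    (\sum_(0 <= k < N * m)
       a N k * (local_poly L k w - \int[P]_w local_poly L 0 w)) / N%:R
    @[N --> \oo] --> (0 : R).
Proof.
move=> Lm aA; set y := \int[P]_w _.
pose B := \sum_(l <- L) M ^+ size l; pose K := A * (B + `|y|).
pose Z j N t w := a N (t * m + j)%N * (local_poly L (t * m + j) w - y).
have ZK j N t w : `|Z j N t w| <= K.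
  rewrite normrM ler_pM// (le_trans (ler_normB _ _))// lerD2r.
  exact: local_poly_le.
have Zin j N t :
    poly_in c (fun i => t * m + j <= i < t * m + j + m)%N (Z j N t).
  apply: poly_inM; first exact: poly_in_cst.
  by apply: poly_inD; [exact: local_poly_in|exact: poly_in_cst].
have bl k : bounded_mfun (local_poly L k).
  exact: (poly_in_bounded c_bounded (local_poly_in k Lm)).
have Z0 j N t : \int[P]_w Z j N t w = 0.
  have by_ : bounded_mfun (fun _ : Omega => y) by exact: bounded_mfun_cst.
  rewrite meanZ; last exact: bounded_mfunB.
  by rewrite meanB// mean_local_poly mean_cst subrr mulr0.
have H j : \forall w \ae P,
    (\sum_(t < N) Z j N t w) / N%:R @[N --> \oo] --> (0 : R).
  apply: (@as_cvg_of_fourth_moment _ _ _ P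
    (fun N w => \sum_(t < N) Z j N t w) (3 * K ^+ 4)).
    by move=> N; apply: bounded_mfun_sum => t; exact: (poly_in_bounded c_bounded).
  move=> N; rewrite mulrAC; apply: fourth_moment_sum => //.
    by move=> t; exact: (poly_in_bounded c_bounded).
  move=> t i i'.
  (* The window of each earlier term of the class ends before [t * m + j], where the window of the
     new term starts. *)
  apply: (mean_poly_inM c_bounded c_indep
    (I := fun k => (k < t * m + j)%N) (J := fun k => (t * m + j <= k)%N)).
  - by move=> k; lia.
  - apply: poly_inX; apply: poly_in_sum => s _; apply: poly_in_sub (Zin _ _ _).
    by move=> k /andP[_ /leq_trans]; apply; have := ltn_ord s; nia.
  - by apply: poly_inX; apply: poly_in_sub (Zin _ _ _) => k /andP[].
have := ae_foralln H; apply: filterS => w Hw.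
under eq_fun do rewrite big_nat_blocks mulr_suml.
have := @cvgn_sum R R _ (index_enum 'I_m)
  (fun j N => (\sum_(t < N) Z j N t w) / N%:R) (fun=> 0) (fun j => Hw j).
by rewrite big1.
Qed.

End weighted_law_of_large_numbers.

(** * Powers of tridiagonal matrices as sums over walks *)

Section tridiagonal_walks.
Context (R : realType).
Implicit Types (b : nat -> R) (N q : nat).

Lemma sum_tridiag_row N b (F : nat -> R) (i : 'I_N) :
  \sum_(j < N) tridiag N b i j * F j =
  (if (i.+1 < N)%N then b i * F i.+1 else 0) +
  (if (0 < i)%N then b i.-1 * F i.-1 else 0).
Proof.
transitivity (\sum_(j < N) ((if j == i.+1 :> nat then b i * F i.+1 else 0) +
    (if i == j.+1 :> nat then b j * F j else 0))).
  apply: eq_bigr => j _; rewrite mxE; case: eqP => [->|_].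
    by rewrite ltn_eqF// addr0.
  by rewrite add0r; case: ifP => _; rewrite ?mul0r.
rewrite big_split/=; congr (_ + _).
- case: ltnP => iN; last first.
    by rewrite big1// => j _; case: eqP => // ji; move: (ltn_ord j); rewrite ji ltnNge iN.
  rewrite (bigD1 (Ordinal iN))//= eqxx big1 ?addr0// => j ji.
  by case: eqP => // ji'; move/eqP: ji; case; exact/val_inj.
- case: ltnP => i0; last first.
    by rewrite big1// => j _; case: eqP => // ij; move: i0; rewrite ij.
  have iN : (i.-1 < N)%N by rewrite (leq_ltn_trans (leq_pred _)).
  rewrite (bigD1 (Ordinal iN))//= prednK// eqxx big1 ?addr0// => j ji.
  by case: eqP => // ij; move/eqP: ji; case; apply/val_inj; rewrite /= ij.
Qed.

(* [walk b q i j]: total weight of the nearest-neighbour walks of [q] steps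
   from [i] to [j] on the half line; the edge [{k, k + 1}] has weight [b k]. *)
Fixpoint walk b (q i j : nat) : R :=
  if q is q'.+1 then
    b i * walk b q' i.+1 j + (if (0 < i)%N then b i.-1 * walk b q' i.-1 j else 0)
  else (i == j)%:R.

(** In [q] steps from [i] a walk stays below [N], so the upper end of the matrix is not felt and the
    half line gives the same sum. *)
Lemma tridiag_exp_walk N b q (i j : 'I_N) : (i + q < N)%N ->
  (tridiag N b ^+ q) i j = walk b q i j.
Proof.
elim: q i => [|q IHq] i iqN.
  by rewrite expr0 mxE /= (inj_eq val_inj).
rewrite exprS mxE -[RHS]/(b i * walk b q i.+1 j +
  (if (0 < i)%N then b i.-1 * walk b q i.-1 j else 0)).
have -> : b i * walk b q i.+1 j =
    if (i.+1 < N)%N then b i * walk b q i.+1 j else 0.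
  by rewrite ifT//; move: iqN; rewrite -addSnnS => /(leq_ltn_trans _); apply; rewrite leq_addr.
rewrite -(sum_tridiag_row b (walk b q ^~ j)); apply: eq_bigr => k _.
rewrite mxE; case: eqP => [ki|_]; first by rewrite IHq// ki addSnnS.
case: eqP => [ik|_]; last by rewrite !mul0r.
by rewrite IHq//; move: iqN; rewrite ik; lia.
Qed.

(** Each walk from [o] to [p] is recorded as the list of its edges, an edge being named by its lower
    end. No weight occurs, so one list serves every translate of the walk. *)
Fixpoint walk_edges (q o p : nat) : seq (seq nat) :=
  if q is q'.+1 then
    [seq o :: l | l <- walk_edges q' o.+1 p] ++
    [seq o.-1 :: l | l <- walk_edges q' o.-1 p]
  else if o == p then [:: [::]] else [::].

(** As long as [q <= o], no step is blocked at the origin and the predecessor commutes with the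
    translation by [k]. *)
Lemma walk_edgesE b (k q o p : nat) : (q <= o)%N ->
  walk b q (k + o) (k + p) =
  \sum_(l <- walk_edges q o p) \prod_(i <- l) b (k + i)%N.
Proof.
elim: q o => [|q IHq] o qo /=.
  rewrite eqn_add2l; case: eqP => _; first by rewrite big_seq1 big_nil.
  by rewrite big_nil.
rewrite big_cat/= !big_map; congr (_ + _).
  rewrite -addnS IHq 1?mulr_sumr; last by lia.
  by apply: eq_bigr => l _; rewrite big_cons.
rewrite ifT; last by lia.
have -> : (k + o).-1 = (k + o.-1)%N by lia.
rewrite IHq 1?mulr_sumr; last by lia.
by apply: eq_bigr => l _; rewrite big_cons.
Qed.

Lemma walk_edges_lt q o p : all (all (fun i => i < o + q)%N) (walk_edges q o p).
Proof.
elim: q o => [|q IHq] o /=; first by case: eqP.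
rewrite all_cat !all_map; apply/andP; split.
  apply: sub_all (IHq o.+1) => l /= ls; apply/andP; split; first by lia.
  by apply: sub_all ls => i; lia.
apply: sub_all (IHq o.-1) => l /= ls; apply/andP; split; first by lia.
by apply: sub_all ls => i; lia.
Qed.

End tridiagonal_walks.

(** * Norm bounds and the cost of sorting the letters of a word *)

Section row_sums.
Context (R : realType).

(** The largest absolute row sum is the operator norm for the sup norm on columns: it is
    submultiplicative, bounds every entry, and is bounded uniformly in [N] for the matrices at
    hand. *)
Definition row_sum_le N (A : 'M[R]_N) (K : R) : Prop :=
  forall i, \sum_j `|A i j| <= K.

Lemma row_sum_le_entry N (A : 'M[R]_N) K i j : row_sum_le A K -> `|A i j| <= K.
Proof.
by move=> /(_ i); apply: le_trans; rewrite (bigD1 j)//= lerDl; exact: sumr_ge0.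
Qed.

Lemma row_sum_leM N (A B : 'M[R]_N) K L : 0 <= L ->
  row_sum_le A K -> row_sum_le B L -> row_sum_le (A * B) (K * L).
Proof.
move=> L0 AK BL i.
apply: (@le_trans _ _ (\sum_j \sum_k `|A i k| * `|B k j|)).
  apply: ler_sum => j _; rewrite mxE (le_trans (ler_norm_sum _ _ _))//.
  by apply: ler_sum => k _; rewrite normrM.
rewrite exchange_big/=; apply: (@le_trans _ _ (\sum_k `|A i k| * L)).
  by apply: ler_sum => k _; rewrite -mulr_sumr ler_wpM2l.
by rewrite -mulr_suml ler_wpM2r.
Qed.

Lemma row_sum_le1 N : row_sum_le (1 : 'M[R]_N) 1.
Proof.
move=> i; rewrite (bigD1 i)//= mxE eqxx normr1 big1 ?addr0// => j ji.
by rewrite mxE eq_sym (negbTE ji) normr0.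
Qed.

Lemma row_sum_leX N (A : 'M[R]_N) K n : 0 <= K ->
  row_sum_le A K -> row_sum_le (A ^+ n) (K ^+ n).
Proof.
move=> K0 AK; elim: n => [|n IHn]; first exact: row_sum_le1.
by rewrite !exprS; apply: row_sum_leM => //; exact: exprn_ge0.
Qed.

Lemma row_sum_leW N (A : 'M[R]_N) K L : K <= L -> row_sum_le A K -> row_sum_le A L.
Proof. by move=> KL AK i; exact: le_trans (AK i) KL. Qed.

Definition abs_sum N (A : 'M[R]_N) : R := \sum_i \sum_j `|A i j|.

(** Duality between the entrywise l1 norm and the largest entry, the latter being at most the row
    sum. *)
Lemma trace_mul_le N (A B : 'M[R]_N) K :
  row_sum_le B K -> `|\tr (A * B)| <= K * abs_sum A.
Proof.
move=> BK; rewrite /mxtrace (le_trans (ler_norm_sum _ _ _))// mulr_sumr.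
apply: ler_sum => i _; rewrite mxE (le_trans (ler_norm_sum _ _ _))// mulr_sumr.
by apply: ler_sum => j _; rewrite normrM mulrC ler_wpM2r// (row_sum_le_entry _ _ BK).
Qed.

Definition word N (A B : 'M[R]_N) (s : seq 'I_2) : 'M[R]_N :=
  \prod_(i <- s) (if i == ord0 then A else B).

Lemma row_sum_le_word N (A B : 'M[R]_N) K s : 0 <= K ->
  row_sum_le A K -> row_sum_le B K -> row_sum_le (word A B s) (K ^+ size s).
Proof.
move=> K0 AK BK; rewrite /word; elim: s => [|i s IHs].
  by rewrite big_nil; exact: row_sum_le1.
rewrite big_cons/= exprS; apply: row_sum_leM => //; first exact: exprn_ge0.
by case: ifP.
Qed.

(** With [[B, A]] the commutator, [B A ^ (r+1) - A ^ (r+1) B = [B, A] A ^ r + A (B A ^ r - A ^ r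
    B)]; in the second term the factor [A] is absorbed into [U]. The constant, [r K ^ (r-1)] in
    closed form, depends neither on [N] nor on the matrices. *)
Lemma trace_swap_power (K : R) (r : nat) : 0 <= K ->
  exists2 c : R, 0 <= c & forall N (A B U V : 'M[R]_N) (u v : R), 0 <= u -> 0 <= v ->
    row_sum_le A K -> row_sum_le U u -> row_sum_le V v ->
    `|\tr (U * (B * A ^+ r) * V) - \tr (U * (A ^+ r * B) * V)| <=
    c * u * v * abs_sum (B * A - A * B).
Proof.
move=> K0; elim: r => [|r [c c0 IHr]].
  exists 0 => // N A B U V u v u0 v0 _ _ _.
  by rewrite expr0 mulr1 mul1r subrr normr0 !mul0r.
exists (K ^+ r + c * K) => [|N A B U V u v u0 v0 AK Uu Vv].
  by rewrite addr_ge0 ?mulr_ge0 ?exprn_ge0.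
have -> : \tr (U * (B * A ^+ r.+1) * V) - \tr (U * (A ^+ r.+1 * B) * V) =
    \tr ((B * A - A * B) * (A ^+ r * V * U)) +
    (\tr (U * A * (B * A ^+ r) * V) - \tr (U * A * (A ^+ r * B) * V)).
  (* Cyclicity of the trace rotates the commutator to the front, where [trace_mul_le] applies. *)
  have -> : \tr ((B * A - A * B) * (A ^+ r * V * U)) =
      \tr (U * ((B * A - A * B) * A ^+ r) * V).
    by rewrite -[LHS]/(\tr ((B * A - A * B) *m (A ^+ r * V * U))) mxtrace_mulC
      -[X in X = _]/(\tr ((A ^+ r * V * U) * (B * A - A * B)))
      -!mulrA -[X in X = _]/(\tr (A ^+ r *m (V * (U * (B * A - A * B)))))
      mxtrace_mulC -[X in X = _]/(\tr ((V * (U * (B * A - A * B))) * A ^+ r))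
      -!mulrA -[X in X = _]/(\tr (V *m (U * ((B * A - A * B) * A ^+ r)))) mxtrace_mulC
      -[X in X = _]/(\tr ((U * ((B * A - A * B) * A ^+ r)) * V)) !mulrA.
  rewrite -!raddfB -raddfD; congr (\tr _).
  rewrite exprS !mulrBl !mulrBr !mulrBl !mulrA [RHS]addrA.
  by rewrite subrK.
set t := abs_sum _.
have -> : (K ^+ r + c * K) * u * v * t = K ^+ r * v * u * t + c * (u * K) * v * t.
  by ring.
rewrite (le_trans (ler_normD _ _))// lerD//.
  have VU : row_sum_le (A ^+ r * V * U) (K ^+ r * v * u).
    by apply: row_sum_leM => //; apply: row_sum_leM => //; exact: row_sum_leX.
  exact: trace_mul_le.
by apply: IHr => //; [exact: mulr_ge0|exact: row_sum_leM].
Qed.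

(* Sorting the letters of a word costs one commutator per transposition. *)
Lemma trace_word_sort (K : R) (s : seq 'I_2) : 0 <= K ->
  exists2 c : R, 0 <= c & forall N (A B U : 'M[R]_N) (u : R), 0 <= u ->
    row_sum_le A K -> row_sum_le B K -> row_sum_le U u ->
    `|\tr (U * word A B s) -
      \tr (U * (A ^+ count_mem ord0 s * B ^+ count (predC1 ord0) s))| <=
    c * u * abs_sum (B * A - A * B).
Proof.
move=> K0; elim: s => [|i s [c c0 IHs]].
  exists 0 => // N A B U u u0 _ _ _.
  by rewrite /word /= big_nil !expr0 !mulr1 subrr normr0 !mul0r.
rewrite /=; have [->|i0] := eqVneq i ord0.
  (* A leading [A] is already in place and joins the prefix [U]. *)
  exists (c * K); first exact: mulr_ge0.
  move=> N A B U u u0 AK BK Uu; rewrite /word big_cons eqxx -/(word A B s) /= add1n add0n.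
  rewrite exprS -[A * _ * _]mulrA !(mulrA U A).
  rewrite (_ : c * K * u = c * (u * K)); last by ring.
  by apply: IHs => //; [exact: mulr_ge0|exact: row_sum_leM].
(* A leading [B] first joins the prefix while the tail is sorted, and is then moved past the block
   [A ^+ r] so produced. *)
have [c' c'0 H] := trace_swap_power (count_mem ord0 s) K0.
exists (c * K + c' * K ^+ count (predC1 ord0) s).
  by rewrite addr_ge0 ?mulr_ge0 ?exprn_ge0.
move=> N A B U u u0 AK BK Uu.
rewrite /word big_cons (negbTE i0) -/(word A B s) /= add0n add1n.
set r := count_mem _ _ in H *; set q := count _ _.
have h1 := IHs N A B (U * B) (u * K) (mulr_ge0 u0 K0) AK BK (row_sum_leM K0 Uu BK).
have h2 := H N A B U (B ^+ q) u (K ^+ q) u0 (exprn_ge0 _ K0) AK Uu (row_sum_leX q K0 BK).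
rewrite mulrA -[X in `|X|](subrKA (\tr (U * B * (A ^+ r * B ^+ q)))).
set t := abs_sum _ in h1 h2 *.
have -> : (c * K + c' * K ^+ q) * u * t = c * (u * K) * t + c' * u * K ^+ q * t.
  by ring.
rewrite (le_trans (ler_normD _ _))// lerD//.
have -> : U * B * (A ^+ r * B ^+ q) = U * (B * A ^+ r) * B ^+ q by rewrite !mulrA.
have -> : U * (A ^+ r * B ^+ q.+1) = U * (A ^+ r * B) * B ^+ q by rewrite exprS !mulrA.
exact: h2.
Qed.

End row_sums.

(** * The diagonal and tridiagonal matrices: bounds, commutator, boundary terms *)

Section tridiagonal_traces.
Context (R : realType).
Implicit Types (b : nat -> R) (sigma : nat -> nat -> R) (N : nat).

Lemma norm_tridiag N b (i j : 'I_N) :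
  `|tridiag N b i j| = tridiag N (fun k => `|b k|) i j.
Proof. by rewrite !mxE; case: ifP => // _; case: ifP => // _; rewrite normr0. Qed.

Lemma row_sum_le_tridiag N b M : (forall k, `|b k| <= M) ->
  row_sum_le (tridiag N b) (2 * M).
Proof.
move=> bM i; have M0 : 0 <= M by rewrite (le_trans _ (bM 0%N)).
rewrite (eq_bigr (fun j : 'I_N => tridiag N (fun k => `|b k|) i j * 1)); last first.
  by move=> j _; rewrite norm_tridiag mulr1.
rewrite (@sum_tridiag_row _ _ _ (fun=> 1)) mulrDl mul1r !mulr1.
by apply: lerD; case: ifP.
Qed.

Lemma row_sum_le_diag_array N sigma C :
  (forall k, (k < N)%N -> `|sigma N k| <= C) ->
  row_sum_le (diag_array sigma N) C.
Proof.
move=> sC i; rewrite (bigD1 i)//= big1 ?addr0; first by rewrite !mxE eqxx mulr1n sC.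
by move=> j ji; rewrite !mxE eq_sym (negbTE ji) mulr0n normr0.
Qed.

Lemma diag_array_exp N sigma r :
  diag_array sigma N ^+ r = diag_mx (\row_(k < N) sigma N k ^+ r).
Proof.
elim: r => [|r IHr].
  rewrite expr0; apply/matrixP => i j; rewrite !mxE expr0.
  by case: (i == j).
rewrite exprS IHr -[LHS]/(diag_array sigma N *m _) mulmx_diag.
by congr diag_mx; apply/rowP => j; rewrite !mxE exprS.
Qed.

Lemma trace_diag_tridiag N sigma b r q :
  \tr (diag_array sigma N ^+ r *m tridiag N b ^+ q) =
  \sum_(i < N) sigma N i ^+ r * (tridiag N b ^+ q) i i.
Proof.
rewrite diag_array_exp mul_diag_mx /mxtrace.
by apply: eq_bigr => i _; rewrite !mxE.
Qed.

(** Each increment of [sigma] occurs in two entries of the commutator, one above and one below the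
    diagonal; hence the factor 2. *)
Lemma abs_sum_commutator_le N sigma b M : (forall k, `|b k| <= M) ->
  abs_sum (tridiag N b * diag_array sigma N - diag_array sigma N * tridiag N b)
  <= 2 * M * \sum_(0 <= k < N.-1) `|sigma N k - sigma N k.+1|.
Proof.
move=> bM; have M0 : 0 <= M by rewrite (le_trans _ (bM 0%N)).
pose s := sigma N.
have entry (i j : 'I_N) :
    `|(tridiag N b * diag_array sigma N - diag_array sigma N * tridiag N b) i j| =
    tridiag N (fun k => `|b k|) i j * `|s j - s i|.
  rewrite -norm_tridiag -normrM; congr `|_|.
  rewrite [LHS]mxE [X in _ + X]mxE.
  rewrite -!mulmxE.
  by rewrite mul_mx_diag mul_diag_mx [X in X - _]mxE [X in _ - X]mxE !(mxE _ _ ord0) mulrBr [X in _ - X]mulrC.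
(* Extending the increments by 0 at the last row lets both off-diagonals be summed over all
   [i < N]. *)
pose g k := if (k.+1 < N)%N then `|s k - s k.+1| else 0.
have g0 k : 0 <= g k by rewrite /g; case: ifP.
have gE : \sum_(0 <= k < N.-1) `|s k - s k.+1| = \sum_(0 <= k < N) g k.
  case: N @s entry @g g0 => [|N] s entry g g0; first by rewrite !big_geq.
  rewrite /= [RHS]big_nat_recr//= {2}/g ltnn addr0.
  by apply: eq_big_nat => k /andP[_ kN]; rewrite /g ltnS kN.
rewrite gE /abs_sum.
apply: (@le_trans _ _ (\sum_(i < N) (M * g i + M * (if (0 < i)%N then g i.-1 else 0)))).
  apply: ler_sum => i _; under eq_bigr do rewrite entry.
  rewrite (@sum_tridiag_row _ _ _ (fun j => `|s j - s i|)); apply: lerD.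
    by rewrite /g distrC; case: ifP => _; rewrite ?mulr0// ler_wpM2r.
  case: ltnP => i0; last by rewrite mulr0.
  by rewrite /g prednK// ltn_ord ler_wpM2r.
rewrite big_split/= -!mulr_sumr -[leRHS]mulrA mulrDl mul1r lerD ?ler_wpM2l//.
  by rewrite big_mkord.
clear gE entry; case: N @s @g g0 => [|N] s g g0; first by rewrite big_ord0 big_geq.
rewrite big_ord_recl/= add0r big_nat_recr//= big_mkord.
by rewrite lerDl.
Qed.

(** With [i = k + q], the second sum runs over the bulk [q <= i < N - q], so only [q] indices at
    each end are lost. The range [N * m] contains the bulk because [m] is positive, and its excess
    contributes 0. *)
Lemma bulk_sum_le (f g : nat -> R) (G : R) (N m q : nat) : (0 < m)%N -> 0 <= G ->
  (forall i, (i < N)%N -> `|f i| <= G) ->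
  (forall k, (k + q.*2 < N)%N -> f (k + q)%N = g k) ->
  `|\sum_(0 <= i < N) f i -
    \sum_(0 <= k < N * m) (if (k + q.*2 < N)%N then g k else 0)| <= q.*2%:R * G.
Proof.
move=> m0 G0 fG fg.
have sumG a1 a2 : (a1 <= a2 <= N)%N ->
    `|\sum_(a1 <= i < a2) f i| <= (a2 - a1)%:R * G.
  move=> /andP[h1 h2]; rewrite (le_trans (ler_norm_sum _ _ _))//.
  rewrite (@le_trans _ _ (\sum_(a1 <= i < a2) G))//.
    rewrite big_nat [leRHS]big_nat; apply: ler_sum => i /andP[_ ia].
    by apply: fG; exact: leq_trans ia h2.
  by rewrite sumr_const_nat -[leLHS]mulr_natl.
have [Nq|qN] := leqP N q.*2.
  rewrite [X in _ - X]big1 ?subr0; last by move=> k _; rewrite ifF//; lia.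
  by rewrite (le_trans (sumG _ _ _)) ?leqnn// subn0 ler_wpM2r// ler_nat.
have NmN : (N - q.*2 <= N * m)%N by rewrite (leq_trans (leq_subr _ _))// leq_pmulr.
rewrite [X in _ - X](big_cat_nat (n := (N - q.*2)%N))//=.
rewrite [X in _ - (_ + X)]big_nat [X in _ - (_ + X)]big1 ?addr0; last first.
  by move=> k /andP[k1 k2]; rewrite ifF//; lia.
have -> : \sum_(0 <= k < N - q.*2) (if (k + q.*2 < N)%N then g k else 0) =
    \sum_(q <= i < N - q) f i.
  rewrite -[RHS]/(\sum_(0 + q <= i < N - q) f i) big_addn (_ : N - q - q = N - q.*2)%N; last by lia.
  apply: eq_big_nat => k /andP[_ kN]; rewrite ifT ?fg//; lia.
rewrite (big_cat_nat (n := q))//=; last by lia.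
rewrite [X in _ + X - _](big_cat_nat (n := (N - q)%N))//=; [|lia|lia].
set x := \sum_(0 <= i < q) _; set y := \sum_(q <= i < N - q) _; set z := \sum_(_ <= i < N) _.
rewrite (_ : x + (y + z) - y = x + z); last by ring.
rewrite (le_trans (ler_normD _ _))// -addnn natrD mulrDl lerD//.
  by rewrite (le_trans (sumG _ _ _))// ?subn0//; lia.
rewrite (le_trans (sumG _ _ _))//; first by lia.
by rewrite ler_wpM2r// ler_nat; lia.
Qed.

End tridiagonal_traces.

(** * Law of large numbers for weighted diagonal entries *)

Lemma eq_cvgn (T : topologicalType) (u v : nat -> T) (l : T) :
  v =1 u -> u n @[n --> \oo] --> l -> v n @[n --> \oo] --> l.
Proof. by move=> /funext ->. Qed.

Lemma bounded_over_n_cvg0 (R : realType) (u : nat -> R) (K : R) :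
  (forall n, `|u n| <= K) -> u n / n%:R @[n --> \oo] --> (0 : R).
Proof.
move=> uK; apply/cvgrPdist_lt => e e0.
have K0 : 0 <= K by rewrite (le_trans _ (uK 0%N)).
exists (Num.truncn (K / e)).+1 => // n /= nK.
rewrite sub0r normrN normrM normfV normr_nat.
have n0 : 0 < n%:R :> R by rewrite ltr0n (leq_trans _ nK).
rewrite ltr_pdivrMr// (le_lt_trans (uK n))// mulrC -ltr_pdivrMr//.
by rewrite (lt_le_trans (truncnS_gt _))// ler_nat.
Qed.

Section trace_law_of_large_numbers.
Context (R : realType) (d : measure_display) (Omega : measurableType d)
  (P : probability Omega R).
Variables (c : nat -> Omega -> R) (M : R).
Hypothesis c_measurable : forall k, measurable_fun setT (c k).
Hypothesis c_le : forall k w, `|c k w| <= M.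
Hypothesis c_indep : forall (s : seq nat) (A : nat -> set R), uniq s ->
  (forall k, measurable (A k)) ->
  P (\bigcap_(k in [set` s]) (c k @^-1` A k)) =
  (\prod_(k <- s) P (c k @^-1` A k))%E.
Hypothesis c_moments : forall k n,
  \int[P]_w (c k w ^+ n) = \int[P]_w (c 0 w ^+ n).

(** The difference splits into the centred weighted sum of bulk entries and two boundary errors, one
    for the trace and one for the sum of the weights; both errors are bounded before division by
    [N]. *)
Lemma trace_lln (sigma : nat -> nat -> R) (C : R) (q r : nat) :
  (forall N k, (k < N)%N -> `|sigma N k| <= C) ->
  \forall w \ae P,
    ntr (diag_array sigma N ^+ r *m tridiag N (c ^~ w) ^+ q) -
    (\int[P]_w local_poly c (walk_edges q q q) 0 w) *
      ((\sum_(0 <= i < N) sigma N i ^+ r) / N%:R) @[N --> \oo] --> (0 : R).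
Proof.
move=> sC; set L := walk_edges q q q; set y := \int[P]_w _.
have C0 : 0 <= C by rewrite (le_trans _ (sC 1 0 _)).
have M0 : 0 <= M by rewrite (le_trans _ (c_le 0 point)).
have M20 : 0 <= 2 * M by rewrite mulr_ge0.
(* A walk of [q] steps from [q] uses edges below [q + q]; the successor keeps the period positive
   when [q = 0]. *)
pose m := (q + q).+1.
(* The weights vanish outside the bulk, so the sums may run over the full periods [k < N * m]. *)
pose a N k := if (k + q.*2 < N)%N then sigma N (k + q)%N ^+ r else 0.
have sCr N k : (k < N)%N -> `|sigma N k ^+ r| <= C ^+ r.
  by move=> kN; rewrite normrX lerXn2r// ?nnegrE// sC.
have Cr0 : 0 <= C ^+ r by exact: exprn_ge0.
have aC N k : `|a N k| <= C ^+ r.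
  rewrite /a; case: ifP => kN; last by rewrite normr0.
  by rewrite sCr//; lia.
have Lm : all (all (fun i => i < m)%N) L.
  by apply: sub_all (walk_edges_lt q q q) => l; apply: sub_all => i; rewrite /m; lia.
have := weighted_lln c_measurable c_le c_indep c_moments Lm aC.
rewrite -/y; apply: filterS => w lln.
(* Diagonal terms are extended by 0 to all natural indices, so that they can be summed and shifted
   in [nat]. *)
pose f N i := if insub i is Some i' then
  sigma N i ^+ r * (tridiag N (c ^~ w) ^+ q) (i' : 'I_N) i' else 0.
have fE N (i : 'I_N) : f N i = sigma N i ^+ r * (tridiag N (c ^~ w) ^+ q) i i.
  by rewrite /f valK.
have fle N i : (i < N)%N -> `|f N i| <= C ^+ r * (2 * M) ^+ q.
  move=> iN; have -> : i = Ordinal iN by []; rewrite fE normrM ler_pM ?sCr//.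
  apply: (@row_sum_le_entry _ _ _ _ (Ordinal iN) (Ordinal iN)).
  by apply: row_sum_leX => //; exact: row_sum_le_tridiag.
have fY N k : (k + q.*2 < N)%N -> f N (k + q)%N = a N k * local_poly c L k w.
  move=> kN; have kN' : (k + q < N)%N by lia.
  have -> : (k + q)%N = Ordinal kN' by []; rewrite fE/= /a kN; congr (_ * _).
  rewrite tridiag_exp_walk/=; last by lia.
  rewrite walk_edgesE//; apply: eq_bigr => l _.
  by rewrite /monomial big_map.
have h1 N : `|\sum_(0 <= i < N) f N i -
    \sum_(0 <= k < N * m) a N k * local_poly c L k w| <=
    q.*2%:R * (C ^+ r * (2 * M) ^+ q).
  rewrite [X in _ - X](eq_bigr (fun k => if (k + q.*2 < N)%N then
    a N k * local_poly c L k w else 0)).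
    apply: bulk_sum_le => //; first by rewrite mulr_ge0// exprn_ge0.
    + exact: fle.
    + exact: fY.
  by move=> k _; rewrite /a; case: ifP => // _; rewrite mul0r.
have h2 N : `|\sum_(0 <= i < N) sigma N i ^+ r - \sum_(0 <= k < N * m) a N k| <=
    q.*2%:R * C ^+ r.
  by apply: bulk_sum_le => //; exact: sCr.
have k1 := bounded_over_n_cvg0 h1.
have k2 : y * ((\sum_(0 <= i < N) sigma N i ^+ r - \sum_(0 <= k < N * m) a N k)
    / N%:R) @[N --> \oo] --> y * 0.
  by apply: cvgM; [exact: cvg_cst|exact: bounded_over_n_cvg0 h2].
have := cvgB (cvgD lln k1) k2.
rewrite mulr0 subr0 addr0 => h; apply: (eq_cvgn _ (h _ _)) => N.
rewrite !fctE /ntr trace_diag_tridiag.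
have -> : \sum_(i < N) sigma N i ^+ r * (tridiag N (c ^~ w) ^+ q) i i =
    \sum_(0 <= i < N) f N i.
  by rewrite big_mkord; apply: eq_bigr => i _; rewrite fE.
have -> : \sum_(0 <= k < N * m) a N k * (local_poly c L k w - y) =
    \sum_(0 <= k < N * m) a N k * local_poly c L k w -
    (\sum_(0 <= k < N * m) a N k) * y.
  by rewrite mulr_suml -sumrB; apply: eq_bigr => k _; rewrite mulrBr.
by ring.
Qed.

End trace_law_of_large_numbers.

(** * Spectrum of real symmetric matrices *)

Section symmetric_spectrum.
Local Open Scope complex_scope.
Context (R : realType).

Lemma char_poly_conj (F : fieldType) N (Q D : 'M[F]_N) : Q \in unitmx ->
  char_poly (invmx Q *m D *m Q) = char_poly D.
Proof.
move=> Qu; rewrite /char_poly.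
have QQ : map_mx polyC (invmx Q) *m map_mx polyC Q = 1%:M.
  by rewrite -map_mxM mulVmx// map_mx1.
have -> : char_poly_mx (invmx Q *m D *m Q) =
    map_mx polyC (invmx Q) *m char_poly_mx D *m map_mx polyC Q.
  rewrite /char_poly_mx !map_mxM mulmxBr mulmxBl; congr (_ - _).
  by rewrite mul_mx_scalar -scalemxAl QQ scalemx1.
by rewrite det_mulmx det_mulmx mulrAC -det_mulmx QQ det1 mul1r.
Qed.

Lemma trace_exp_conj (F : fieldType) N (Q : 'M[F]_N) (D : 'rV[F]_N) q :
  Q \in unitmx ->
  \tr ((invmx Q *m diag_mx D *m Q) ^+ q) = \sum_i D 0 i ^+ q.
Proof.
move=> Qu.
have -> : (invmx Q *m diag_mx D *m Q) ^+ q =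
    invmx Q *m diag_mx (\row_i D 0 i ^+ q) *m Q.
  elim: q => [|q IHq].
    rewrite expr0 (_ : \row_i _ = const_mx 1); last by apply/rowP => i; rewrite !mxE.
    by rewrite diag_const_mx mulmx1 mulVmx.
  rewrite exprS IHq -mulmxE -!mulmxA (mulmxA Q) mulmxV// mul1mx !mulmxA; congr (_ *m _).
  rewrite -!mulmxA mulmx_diag; congr (_ *m diag_mx _).
  by apply/rowP => i; rewrite !mxE exprS.
rewrite mxtrace_mulC mulmxA mulmxV// mul1mx mxtrace_diag.
by apply: eq_bigr => i _; rewrite mxE.
Qed.

(** Over [R[i]] the matrix is hermitian, hence unitarily diagonalizable with real eigenvalues; both
    identities then descend along the injective embedding of [R]. *)
Lemma symmetric_spectrum N (A : 'M[R]_N) : A^T = A ->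
  exists x : 'I_N -> R,
    char_poly A = \prod_i ('X - (x i)%:P) /\
    forall q, \tr (A ^+ q) = \sum_i x i ^+ q.
Proof.
move=> sA; pose AC := map_mx (real_complex R) A.
have hA : AC \is hermsymmx.
  apply: realsym_hermsym.
    by apply/is_hermitianmxP; rewrite expr0 scale1r map_mx_id// /AC map_trmx sA.
  by apply/mxOverP => i j; rewrite mxE; apply/complex_realP; exists (A i j).
have /hermitian_normalmx/orthomx_spectralP AE := hA.
have Dr := hermitian_spectral_diag_real hA.
set Q := spectralmx AC in AE *; set D := spectral_diag AC in AE Dr *.
have Qu : Q \in unitmx by exact: spectral_unit.
have DE i : D 0 i = (complex.Re (D 0 i))%:C.
  by rewrite RRe_real//; exact: (mxOverP Dr).
exists (fun i => complex.Re (D 0 i)); split => [|q].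
- apply: (@map_poly_inj _ _ (real_complex R)).
  rewrite map_char_poly -/AC AE char_poly_conj// char_poly_trig ?diag_mx_is_trig//.
  rewrite rmorph_prod/=; apply: eq_bigr => i _.
  by rewrite map_polyXsubC mxE eqxx mulr1n {1}DE.
- apply: (fmorph_inj (real_complex R)).
  rewrite -[LHS]trace_map_mx rmorphXn/= -/AC AE trace_exp_conj// rmorph_sum/=.
  by apply: eq_bigr => i _; rewrite rmorphXn/= {1}DE.
Qed.

(** For a split polynomial, the multiplicity of a root is the number of its occurrences among the
    linear factors. *)
Lemma eigenvalues_perm N (A : 'M[R]_N) (x : 'I_N -> R) :
  char_poly A = \prod_i ('X - (x i)%:P) ->
  perm_eq (eigenvalues A) [seq x i | i <- index_enum 'I_N].
Proof.
move=> pE; set s := [seq x i | i <- index_enum 'I_N].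
have ps : char_poly A = \prod_(y <- s) ('X - y%:P) by rewrite pE big_map.
have p0 : char_poly A != 0 by rewrite monic_neq0// char_poly_monic.
have rootsE y : (y \in rootsR (char_poly A)) = (y \in s).
  by rewrite -(roots_on_rootsR p0)//= ps root_prod_XsubC.
have ur : uniq (rootsR (char_poly A)) by exact: uniq_roots.
apply/allP => y _ /=; apply/eqP; rewrite /eigenvalues count_flatten -map_comp.
rewrite sumnE big_map.
under eq_bigr do rewrite /= count_nseq ps mu_prod_XsubC.
have [ys|ys] := boolP (y \in s); last first.
  rewrite big1_seq => [|z _]; last first.
    have [->|zy] := eqVneq z y; last by rewrite /= (negbTE zy).
    by rewrite (count_memPn ys) muln0.
  by apply/esym/count_memPn.
rewrite (bigD1_seq y) ?rootsE//= eqxx mul1n big1 ?addn0// => z zy.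
by rewrite (negbTE zy).
Qed.

(** The eigenvector equation is read at a coordinate of largest modulus. Eigenvectors are row
    vectors here, whence the transpose. *)
Lemma eigenvalues_bound N (A : 'M[R]_N) K y :
  row_sum_le A^T K -> y \in eigenvalues A -> `|y| <= K.
Proof.
move=> AK; rewrite /eigenvalues => /flatten_mapP[z zr].
rewrite mem_nseq => /andP[_ /eqP ->] {y}.
have p0 : char_poly A != 0 by rewrite monic_neq0// char_poly_monic.
have : root (char_poly A) z by move: zr; rewrite -(roots_on_rootsR p0).
rewrite -eigenvalue_root_char => /eigenvalueP[v vA v0].
have [j0 vj0] : exists j, v 0 j != 0.
  by apply/existsP; apply: contraNT v0 => /existsPn h; apply/eqP/rowP => j;
     rewrite mxE; apply/eqP/negPn/h.
have [j _ jmax] := @Order.TotalTheory.arg_maxP _ _ _ j0 xpredT (fun j => `|v 0 j|) isT.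
have vj : 0 < `|v 0 j| by rewrite (lt_le_trans _ (jmax j0 isT))// normr_gt0.
rewrite -(ler_pM2r vj) -normrM.
have /rowP/(_ j) := vA; rewrite !mxE => <-.
rewrite (le_trans (ler_norm_sum _ _ _))//.
rewrite (@le_trans _ _ (\sum_i `|A^T j i| * `|v 0 j|))//.
  by apply: ler_sum => i _; rewrite normrM mulrC mxE ler_wpM2l//; exact: jmax.
by rewrite -mulr_suml ler_wpM2r.
Qed.

End symmetric_spectrum.

(** * Truncation, and moments of weak limits of empirical measures *)

Section clip.
Context (R : realType).

(** A bounded continuous substitute for the identity, equal to it on [[- K, K]]; powers of it are
    admissible test functions. *)
Definition clip (K y : R) : R := Num.max (- K) (Num.min K y).

Lemma norm_clip_le K y : 0 <= K -> `|clip K y| <= K.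
Proof.
move=> K0; rewrite /clip ler_norml le_max lexx/= ge_max ge_min lexx/= andbT.
by lra.
Qed.

Lemma clip_id K y : `|y| <= K -> clip K y = y.
Proof. by rewrite ler_norml => /andP[h1 h2]; rewrite /clip min_r// max_r. Qed.

Lemma continuous_clip K : continuous (clip K).
Proof.
move=> y; apply: (@continuous_max _ _ (fun=> - K) (fun y => Num.min K y)).
  exact: cst_continuous.
by apply: (@continuous_min _ _ (fun=> K) id); [exact: cst_continuous|exact: cvg_id].
Qed.

Lemma measurable_clip K : measurable_fun setT (clip K).
Proof.
by apply: measurable_maxr => //; apply: measurable_minr.
Qed.

End clip.

Section empirical_measures.
Context (R : realType).

(** The formula is computed for nonnegative functions and extended through positive and negative
    parts. *)
Lemma Rintegral_empirical (d : measure_display) (E : measurableType d) (n : nat)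
    (x : nat -> E) (f : E -> R) : measurable_fun setT f ->
  \int[empirical R n x]_y f y = (\sum_(0 <= k < n) f (x k)) / n%:R.
Proof.
move=> mf.
have ge0 (g : E -> R) : measurable_fun setT g -> (forall y, 0 <= g y) ->
    (\int[empirical R n x]_y (g y)%:E)%E = ((\sum_(0 <= k < n) g (x k)) / n%:R)%:E.
  move=> mg g0; have meg : measurable_fun setT (EFin \o g) by exact/measurable_EFinP.
  have g0E y : [set: E] y -> (0 <= (g y)%:E)%E by rewrite lee_fin.
  rewrite [LHS]ge0_integral_mscale//= ge0_integral_measure_sum//.
  rewrite (eq_bigr (fun k : 'I_n => (g (x k))%:E)); last first.
    by move=> k _; rewrite [LHS]integral_dirac// diracT mul1e.
  by rewrite sumEFin -EFinM mulrC big_mkord.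
rewrite /Rintegral integralE.
rewrite -[X in (_ X^\+)%E]/(EFin \o f) -[X in (_ X^\-)%E]/(EFin \o f).
rewrite funerpos funerneg !ge0//; last 2 first.
- exact: measurable_funrneg.
- exact: measurable_funrpos.
rewrite -EFinB/= -mulrBl -sumrB; congr (_ / _).
by apply: eq_bigr => k _; rewrite -[RHS](congr1 (@^~ (x k)) (funrposBneg f)).
Qed.

Lemma Rintegral_ae_eq (d : measure_display) (E : measurableType d)
    (mu : probability E R) (f g : E -> R) :
  measurable_fun setT f -> measurable_fun setT g ->
  (\forall y \ae mu, f y = g y) -> \int[mu]_y f y = \int[mu]_y g y.
Proof.
move=> mf mg fg; congr fine; apply: ae_eq_integral => //.
- exact/measurable_EFinP.
- exact/measurable_EFinP.
- by apply: filterS fg => y fgy _; rewrite fgy.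
Qed.

Lemma ae_eq0_of_mean_eq0 (d : measure_display) (E : measurableType d)
    (mu : probability E R) (f : E -> R) :
  bounded_mfun f -> (forall y, 0 <= f y) -> \int[mu]_y f y = 0 ->
  \forall y \ae mu, f y = 0.
Proof.
move=> bf f0 If.
have mf : measurable_fun setT (EFin \o f) by apply/measurable_EFinP; case: bf.
have : (\int[mu]_y `|(EFin \o f) y| = 0)%E.
  under eq_integral do rewrite gee0_abs ?lee_fin//.
  have /integrable_fin_num : mu.-integrable setT (EFin \o f).
    exact: bounded_mfun_integrable.
  by move=> /(_ measurableT)/fineK <-; rewrite -[fine _]/(\int[mu]_y f y) If.
move/(ae_eq_integral_abs mu measurableT mf).
by apply: filterS => y /(_ I) [].
Qed.

Variables (n : nat -> nat) (x : nat -> nat -> R) (mu : probability R R) (K : R).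
Hypothesis x_le : forall N k, (k < n N)%N -> `|x N k| <= K.
Hypothesis K_ge0 : 0 <= K.
Hypothesis x_cvg : forall f : R -> R, continuous f ->
  (exists B : R, forall y, `|f y| <= B) ->
  (\sum_(0 <= k < n N) f (x N k)) / (n N)%:R @[N --> \oo] --> \int[mu]_y f y.

(** The function [min 1 |y - clip K y|] is bounded, continuous and zero at every atom, so its mean
    under the limit is 0: the limit is carried by [[- K, K]]. *)
Lemma limit_law_clip : \forall y \ae mu, clip K y = y.
Proof.
pose f (y : R) := Num.min 1 `|y - clip K y|.
have cf : continuous f.
  move=> y; apply: (@continuous_min _ _ (fun=> 1) (fun y => `|y - clip K y|)).
    exact: cst_continuous.
  apply: (@continuous_comp _ _ _ (fun y => y - clip K y) Num.norm).
    by apply: cvgB; [exact: cvg_id|exact: continuous_clip].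
  exact: norm_continuous.
have f0 y : 0 <= f y by rewrite /f le_min ler01 normr_ge0.
have f1 y : `|f y| <= 1 by rewrite ger0_norm// /f ge_min lexx.
have mf : measurable_fun setT f.
  apply: measurable_minr => //; apply: measurableT_comp => //.
  by apply: measurable_funB => //; exact: measurable_clip.
have fE : \int[mu]_y f y = 0.
  have := x_cvg cf (ex_intro _ 1 f1).
  have -> : (fun N => (\sum_(0 <= k < n N) f (x N k)) / (n N)%:R) = fun=> 0.
    apply/funext => N; rewrite big_nat big1 ?mul0r// => k /andP[_ kn].
    by rewrite /f clip_id ?x_le// subrr normr0 min_r.
  by move=> h; apply/esym; exact: (cvg_unique _ (@cvg_cst _ _ _ _ _) h).
have bf : bounded_mfun f by split => //; exists 1.
have := ae_eq0_of_mean_eq0 bf f0 fE; apply: filterS => y.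
rewrite /f /Order.min; case: ifP => _; first by move/eqP; rewrite oner_eq0.
by move/normr0_eq0/subr0_eq.
Qed.

(** The test function [clip K y ^+ q] agrees with the power at every atom and almost everywhere for
    the limit. *)
Lemma limit_law_moment q :
  (\sum_(0 <= k < n N) x N k ^+ q) / (n N)%:R @[N --> \oo] --> moment q mu.
Proof.
have -> : moment q mu = \int[mu]_y (clip K y ^+ q).
  apply: Rintegral_ae_eq => //.
  - by apply: measurable_funX; exact: measurable_clip.
  - by apply: filterS limit_law_clip => y ->.
have cq : continuous (fun y => clip K y ^+ q).
  move=> y; apply: (@continuous_comp _ _ _ (clip K) (fun z => z ^+ q)).
    exact: continuous_clip.
  exact: exprn_continuous.
have bq : exists B : R, forall y, `|clip K y ^+ q| <= B.
  exists (K ^+ q) => y; rewrite normrX lerXn2r ?nnegrE//; exact: norm_clip_le.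
have := x_cvg cq bq; apply: eq_cvgn => N; congr (_ / _).
by apply: eq_big_nat => k /andP[_ kn]; rewrite clip_id// x_le.
Qed.

End empirical_measures.

(** * Truncation of the off-diagonal variables *)

Section clipped_family.
Context (R : realType) (d : measure_display) (Omega : measurableType d)
  (P : probability Omega R) (b : nat -> {RV P >-> R}) (M : R).
Hypothesis M_ge0 : 0 <= M.

(** Bounded at every sample point, not just almost surely; independence and equality of laws
    survive, being passed through a fixed measurable function. *)
Definition clipped (k : nat) (w : Omega) : R := clip M (b k w).

Lemma measurable_clipped k : measurable_fun setT (clipped k).
Proof. by apply: measurableT_comp => //; exact: measurable_clip. Qed.

Lemma clipped_le k w : `|clipped k w| <= M.
Proof. exact: norm_clip_le. Qed.

Lemma bounded_mfun_clipped k : bounded_mfun (clipped k).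
Proof. by split; [exact: measurable_clipped|exists M => w; exact: clipped_le]. Qed.

Let measurable_clip_preimage (A : set R) :
  measurable A -> measurable (clip M @^-1` A).
Proof. by move=> mA; rewrite -[_ @^-1` _]setTI; exact: measurable_clip. Qed.

Lemma clipped_indep : mutually_independent b ->
  forall (s : seq nat) (A : nat -> set R), uniq s ->
  (forall k, measurable (A k)) ->
  P (\bigcap_(k in [set` s]) (clipped k @^-1` A k)) =
  (\prod_(k <- s) P (clipped k @^-1` A k))%E.
Proof.
move=> ib s A us mA.
exact: (ib s (fun k => clip M @^-1` A k) us (fun k => measurable_clip_preimage (mA k))).
Qed.

Lemma clipped_moments : identically_distributed b ->
  forall k n, \int[P]_w (clipped k w ^+ n) = \int[P]_w (clipped 0 w ^+ n).
Proof.
move=> idb k n.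
have E j : \int[P]_w (clipped j w ^+ n) =
    \int[distribution P (b j)]_y (clip M y ^+ n).
  congr fine; rewrite integral_distribution//.
    apply/measurable_EFinP; apply: measurable_funX; exact: measurable_clip.
  apply: (@bounded_mfun_integrable _ _ _ P (fun w => clipped j w ^+ n)).
  by apply: bounded_mfunX; exact: bounded_mfun_clipped.
rewrite !E; congr fine; apply: eq_measure_integral => A mA _; exact: idb.
Qed.

(** The bound on [b 0] reaches each [b k] through the common law, and countably many null sets are
    discarded together. *)
Lemma clipped_ae : identically_distributed b ->
  distribution P (b 0%N) `[- M, M] = 1%E ->
  \forall w \ae P, forall k, clipped k w = b k w.
Proof.
move=> idb b0; apply: ae_foralln => k.
have mI : measurable (`[- M, M]%classic : set R) by exact: measurable_itv.
have : P (b k @^-1` `[- M, M]) = 1%E by rewrite -[LHS]/(distribution P (b k) _) idb.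
move=> h; exists (~` (b k @^-1` `[- M, M])); split.
- by apply: measurableC; rewrite -[_ @^-1` _]setTI; exact: measurable_funP.
- rewrite [LHS](@probability_setC _ _ _ P); last first.
    by rewrite -[_ @^-1` _]setTI; exact: measurable_funP.
  by rewrite [X in (_ - X)%E]h subee.
- move=> w /=; apply: contra_not; rewrite in_itv/= => h'.
  by rewrite /clipped clip_id// ler_norml.
Qed.

End clipped_family.

(** * Moments of [mu_b] and of [mu_T] *)

Section limit_moments.
Context (R : realType).

Lemma tridiag_sym N (b : nat -> R) : (tridiag N b)^T = tridiag N b.
Proof.
apply/matrixP => i j; rewrite !mxE.
by case: eqP => [e1|_]; case: eqP => [e2|_] //; exfalso; lia.
Qed.

Lemma size_eigenvalues_tridiag N (b : nat -> R) :
  size (eigenvalues (tridiag N b)) = N.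
Proof.
have [x [xc _]] := symmetric_spectrum (tridiag_sym N b).
by rewrite (perm_size (eigenvalues_perm xc)) size_map -sum1_size sum1_card card_ord.
Qed.

Lemma trace_tridiag_exp N (b : nat -> R) q :
  \tr (tridiag N b ^+ q) =
  \sum_(0 <= k < N) (eigenvalues (tridiag N b))`_k ^+ q.
Proof.
have [x [xc ->]] := symmetric_spectrum (tridiag_sym N b).
transitivity (\sum_(y <- eigenvalues (tridiag N b)) y ^+ q).
  by rewrite (perm_big _ (eigenvalues_perm xc)) big_map.
by rewrite (big_nth 0) size_eigenvalues_tridiag.
Qed.

Section tridiagonal_model.
Variables (b : nat -> R) (M : R) (mu : probability R R).
Hypothesis b_le : forall k, `|b k| <= M.
Hypothesis b_cvg : weak_cvg (fun N => esd (tridiag N b)) mu.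

Let M_ge0 : 0 <= M. Proof. by rewrite (le_trans _ (b_le 0)). Qed.

Let eigenvalue_le N k : (k < N)%N ->
  `|(eigenvalues (tridiag N b))`_k| <= 2 * M.
Proof.
move=> kN; apply: (@eigenvalues_bound _ _ (tridiag N b)).
  by rewrite tridiag_sym; exact: row_sum_le_tridiag.
by apply: mem_nth; rewrite size_eigenvalues_tridiag.
Qed.

Let eigenvalue_cvg (f : R -> R) : continuous f ->
  (exists B : R, forall y, `|f y| <= B) ->
  (\sum_(0 <= k < N) f (eigenvalues (tridiag N b))`_k) / N%:R @[N --> \oo]
  --> \int[mu]_y f y.
Proof.
move=> cf bf; have := b_cvg cf bf; apply: eq_cvgn => N.
by rewrite Rintegral_empirical//; exact: continuous_measurable_fun.
Qed.

Lemma tridiag_limit_clip : \forall y \ae mu, clip (2 * M) y = y.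
Proof. exact: (limit_law_clip (n := id) eigenvalue_le eigenvalue_cvg). Qed.

Lemma tridiag_limit_moment q :
  ntr (tridiag N b ^+ q) @[N --> \oo] --> moment q mu.
Proof.
have M20 : 0 <= 2 * M by rewrite mulr_ge0.
have := limit_law_moment (n := id) eigenvalue_le M20 eigenvalue_cvg (q := q).
by apply: eq_cvgn => N; rewrite /ntr mulrC trace_tridiag_exp.
Qed.

End tridiagonal_model.

Section diagonal_array.
Context (d : measure_display) (Omega : measurableType d)
  (Q : probability Omega R) (T : {RV Q >-> R}) (mu : probability R R)
  (sigma : nat -> nat -> R) (C : R).
Hypothesis T_law : has_law T mu.
Hypothesis sigma_le : forall N k, (k < N)%N -> `|sigma N k| <= C.
Hypothesis sigma_cvg : weak_cvg2
  (fun N => empirical R N.-1 (fun k => (sigma N k, sigma N k.+1)))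
  (joint_law T T).

Let C_ge0 : 0 <= C. Proof. by rewrite (le_trans _ (sigma_le (ltn0Sn 0))). Qed.

Lemma mean_joint_law (f : R * R -> R) : bounded_mfun f ->
  \int[joint_law T T]_z f z = \int[Q]_w f (T w, T w).
Proof.
move=> [mf [K fK]]; congr fine; rewrite integral_distribution//.
  exact/measurable_EFinP.
apply: (@bounded_mfun_integrable _ _ _ Q (fun w => f (T w, T w))); split.
  by apply: (measurableT_comp mf); exact: (measurable_pair_fun T T).
by exists K => w.
Qed.

Lemma mean_law (f : R -> R) : bounded_mfun f ->
  \int[mu]_y f y = \int[Q]_w f (T w).
Proof.
move=> [mf [K fK]].
transitivity (\int[distribution Q T]_y f y).
  by congr fine; apply: eq_measure_integral => A mA _; rewrite [RHS]T_law.
congr fine; rewrite integral_distribution//; first exact/measurable_EFinP.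
apply: (@bounded_mfun_integrable _ _ _ Q (fun w => f (T w))); split.
  exact: measurableT_comp.
by exists K => w.
Qed.

Let sigma_le_pred N k : (k < N.-1)%N -> `|sigma N k| <= C.
Proof. by move=> kN; apply: sigma_le; lia. Qed.

(** Test functions of the first coordinate alone give the marginal statement. *)
Let sigma_cvg1 (f : R -> R) : continuous f ->
  (exists B : R, forall y, `|f y| <= B) ->
  (\sum_(0 <= k < N.-1) f (sigma N k)) / N.-1%:R @[N --> \oo]
  --> \int[mu]_y f y.
Proof.
move=> cf [B fB].
have mf : measurable_fun setT f by exact: continuous_measurable_fun.
have mf1 : measurable_fun setT (fun z : R * R => f z.1).
  by apply: measurableT_comp => //; exact: measurable_fst.
have := sigma_cvg (f := fun z => f z.1).
rewrite mean_joint_law; last by split => //; exists B => z.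
rewrite mean_law; last by split => //; exists B.
move=> h; apply: eq_cvgn (h _ _) => [N||].
- by rewrite Rintegral_empirical.
- by move=> z; apply: (@continuous_comp _ _ _ fst f); [exact: cvg_fst|exact: cf].
- by exists B => z.
Qed.

Lemma array_limit_clip : \forall y \ae mu, clip C y = y.
Proof. exact: (limit_law_clip sigma_le_pred sigma_cvg1). Qed.

(** The hypothesis on pairs concerns the first [N.-1] entries; the last entry and the change of
    normalization cost a bounded quantity divided by [N]. *)
Lemma array_limit_moment r :
  (\sum_(0 <= i < N) sigma N i ^+ r) / N%:R @[N --> \oo] --> moment r mu.
Proof.
have h := limit_law_moment sigma_le_pred C_ge0 sigma_cvg1 (q := r).
pose s N := \sum_(0 <= i < N.-1) sigma N i ^+ r.
have Cr0 : 0 <= C ^+ r by exact: exprn_ge0.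
have sr N i : (i < N)%N -> `|sigma N i ^+ r| <= C ^+ r.
  by move=> iN; rewrite normrX lerXn2r ?nnegrE// sigma_le.
(* With [l] the last term and [s] the sum of the others, [(s + l) / N - s / (N-1) = (l - s / (N-1))
   / N]; [u] is this last numerator. *)
pose u N : R := (if N is N'.+1 then sigma N N' ^+ r else 0) - s N / N.-1%:R.
have uB N : `|u N| <= C ^+ r + C ^+ r.
  rewrite (le_trans (ler_normB _ _))// lerD//.
    by case: N => [|N]; rewrite ?normr0 ?sr.
  rewrite normrM normfV normr_nat.
  have [->|n0] := eqVneq N.-1 0%N; first by rewrite invr0 mulr0.
  rewrite ler_pdivrMr ?ltr0n ?lt0n// (le_trans (ler_norm_sum _ _ _))//.
  rewrite (@le_trans _ _ (\sum_(0 <= i < N.-1) C ^+ r))//.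
    rewrite big_nat [leRHS]big_nat; apply: ler_sum => i /andP[_ iN].
    by apply: sr; lia.
  by rewrite sumr_const_nat subn0 mulr_natr.
have k := cvgD h (bounded_over_n_cvg0 uB).
rewrite -[moment r mu]addr0; apply: (eq_cvgn _ (k _)) => N.
rewrite -/(s N) /u; case: N => [|N].
  by rewrite /s !big_geq// mul0r subr0 invr0 mulr0 addr0.
rewrite big_nat_recr//= -[X in X + _]/(s N.+1).
case: N => [|N]; first by rewrite /s big_geq// !mul0r subr0 !add0r.
rewrite -[N.+2%:R]natr1; set y : R := N.+1%:R; have y0 : 0 < y by rewrite ltr0n.
by field; rewrite !gt_eqF//; lra.
Qed.

(** Truncating both coordinates makes their distance a bounded test function, which vanishes on the
    diagonal; passing from [1 / (N-1)] to [1 / N] only decreases the average. *)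
Lemma array_increments_cvg0 :
  (\sum_(0 <= k < N.-1) `|sigma N k - sigma N k.+1|) / N%:R
  @[N --> \oo] --> (0 : R).
Proof.
pose f (z : R * R) := `|clip C z.1 - clip C z.2|.
have fB z : `|f z| <= C + C.
  by rewrite normr_id (le_trans (ler_normB _ _))// lerD// norm_clip_le.
have cf : continuous f.
  move=> z; apply: (@continuous_comp _ _ _ (fun z : R * R => clip C z.1 - clip C z.2) Num.norm); last exact: norm_continuous.
  apply: cvgB.
    by apply: (@continuous_comp _ _ _ fst (clip C)); [exact: cvg_fst|exact: continuous_clip].
  by apply: (@continuous_comp _ _ _ snd (clip C)); [exact: cvg_snd|exact: continuous_clip].
have mf : measurable_fun setT f.
  apply: measurableT_comp => //; apply: measurable_funB.
    by apply: measurableT_comp; [exact: measurable_clip|exact: measurable_fst].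
  by apply: measurableT_comp; [exact: measurable_clip|exact: measurable_snd].
have := sigma_cvg cf (ex_intro _ _ fB).
rewrite mean_joint_law; last by split => //; exists (C + C).
under [X in _ --> X]eq_Rintegral do rewrite /f subrr normr0.
rewrite mean_cst => h.
apply: (@squeeze_cvgr _ _ _ _ (fun=> 0)
  (fun N => \int[empirical R N.-1 (fun k => (sigma N k, sigma N k.+1))]_z f z)).
- apply: nearW => N; rewrite divr_ge0 ?sumr_ge0//=.
  rewrite Rintegral_empirical//.
  rewrite (eq_big_nat _ _ (F2 := fun k => f (sigma N k, sigma N k.+1))); last first.
    by move=> k kN; rewrite /f /= !clip_id// sigma_le//; lia.
  case: N => [|N]; first by rewrite !big_geq// !mul0r.
  case: N => [|N]; first by rewrite !big_geq// !mul0r.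
  apply: ler_wpM2l; first by apply: sumr_ge0 => k _; exact: normr_ge0.
  by rewrite lef_pV2 ?posrE ?ltr0n// ler_nat.
- exact: cvg_cst.
- exact: h.
Qed.

End diagonal_array.

End limit_moments.

(** Serves to identify deterministic limits: several almost sure convergences are compared at one
    common sample point. *)
Lemma ae_exists (R : realType) (d : measure_display) (Omega : measurableType d)
    (P : probability Omega R) (S : Omega -> Prop) :
  (\forall w \ae P, S w) -> exists w, S w.
Proof.
move=> PS; have P0 : (0 < P setT)%E by rewrite [X in (_ < X)%E](probability_setT P).
have PF := ae_properfilter_algebraOfSetsType P0.
exact: (@filter_ex _ _ PF _ PS).
Qed.

Lemma mean_cvg_of_ae (R : realType) (d : measure_display)
    (Omega : measurableType d) (P : probability Omega R)
    (f : nat -> Omega -> R) (l K : R) :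
  (forall n, measurable_fun setT (f n)) -> (forall n w, `|f n w| <= K) ->
  (\forall w \ae P, f n w @[n --> \oo] --> l) ->
  \int[P]_w f n w @[n --> \oo] --> l.
Proof.
move=> mf fK fl.
have [] := @dominated_convergence _ _ _ P setT measurableT
  (fun n w => (f n w)%:E) (fun=> l%:E) (fun=> K%:E).
- by move=> n; exact/measurable_EFinP.
- exact: measurable_cst.
- apply: filterS fl => w wl _; apply/fine_cvgP; split; last exact: wl.
  exact: nearW.
- by apply: (@bounded_mfun_integrable _ _ _ P (fun=> K)); exact: bounded_mfun_cst.
- by apply: aeW => w n _; rewrite lee_fin.
move=> _ _; rewrite integral_cst// [X in (_ * X)%E](probability_setT P) mule1.
by move=> /fine_cvg.
Qed.

(** * Limits of traces of words, almost surely and in mean *)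

Section word_traces.
Context (R : realType) (d : measure_display) (Omega : measurableType d)
  (P : probability Omega R) (b : nat -> {RV P >-> R}) (M : R)
  (sigma : nat -> nat -> R) (C : R) (mu_T mu_b : probability R R)
  (d' : measure_display) (Omega' : measurableType d')
  (Q : probability Omega' R) (T : {RV Q >-> R}).
Hypothesis M_ge0 : 0 <= M.
Hypothesis b_iid : iid b.
Hypothesis b_bounded : distribution P (b 0%N) `[- M, M] = 1%E.
Hypothesis sigma_le : forall N k, (k < N)%N -> `|sigma N k| <= C.
Hypothesis mu_b_limit : tridiag_limit_law b mu_b.
Hypothesis T_law : has_law T mu_T.
Hypothesis sigma_cvg : weak_cvg2
  (fun N => empirical R N.-1 (fun k => (sigma N k, sigma N k.+1)))
  (joint_law T T).

Local Notation c := (clipped b M).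

Let C_ge0 : 0 <= C. Proof. by rewrite (le_trans _ (sigma_le (ltn0Sn 0))). Qed.

Lemma clipped_limit_law :
  \forall w \ae P, weak_cvg (fun N => esd (tridiag N (c ^~ w))) mu_b.
Proof.
have [_ idb] := b_iid.
apply: filterS2 (clipped_ae idb b_bounded) mu_b_limit => w cb.
by have -> : c ^~ w = (fun k => b k w) by apply/funext => k; rewrite cb.
Qed.

Lemma mu_b_clip : \forall y \ae mu_b, clip (2 * M) y = y.
Proof.
have [w wl] := ae_exists clipped_limit_law.
by apply: tridiag_limit_clip wl => k; exact: clipped_le.
Qed.

Lemma mean_walks_moment q :
  \int[P]_w local_poly c (walk_edges q q q) 0 w = moment q mu_b.
Proof.
have [ib idb] := b_iid.
have h0 : forall N k : nat, (k < N)%N -> `|0 : R| <= 0 by rewrite normr0.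
(* Taking [sigma] zero and [r = 0] gives unit weights, since [0 ^+ 0 = 1]. *)
have h := trace_lln (measurable_clipped b M) (clipped_le b M_ge0) (clipped_indep M ib)
  (clipped_moments M_ge0 idb)
  (sigma := fun _ _ => 0) q 0 h0.
have {h}h : \forall w \ae P,
    ntr (tridiag N (c ^~ w) ^+ q) -
    \int[P]_w local_poly c (walk_edges q q q) 0 w @[N --> \oo] --> (0 : R).
  apply: filterS h => w; apply: cvg_trans; apply: near_eq_cvg.
  (* The average of the unit weights is 1 only for positive [N]; at [N = 0] it is 0. *)
  exists 1%N => // N /= N0.
  have -> : (\sum_(0 <= i < N) 0 ^+ 0) / N%:R = 1 :> R.
    by rewrite sumr_const_nat subn0 expr0 divff// pnatr_eq0 -lt0n.
  by rewrite mulr1 expr0 mul1mx.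
have [w [wl]] := ae_exists (filterI clipped_limit_law h).
set y := \int[P]_w _ => wy.
have := tridiag_limit_moment (fun k => clipped_le b M_ge0 k w) wl (q := q).
apply: cvg_unique; first exact: Rhausdorff.
have k := cvgD wy (@cvg_cst _ y _ \oo _); rewrite add0r in k.
by apply: (eq_cvgn _ (k _ _)) => N; rewrite /= subrK.
Qed.

Lemma trace_cvg r q : \forall w \ae P,
  ntr (diag_array sigma N ^+ r *m tridiag N (c ^~ w) ^+ q)
  @[N --> \oo] --> moment r mu_T * moment q mu_b.
Proof.
have [ib idb] := b_iid.
have := trace_lln (measurable_clipped b M) (clipped_le b M_ge0) (clipped_indep M ib)
  (clipped_moments M_ge0 idb) q r sigma_le.
rewrite mean_walks_moment; apply: filterS => w h.
have s := array_limit_moment T_law sigma_le sigma_cvg (r := r).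
rewrite -[X in _ --> X]add0r [X in _ --> 0 + X]mulrC.
pose S N := moment q mu_b * ((\sum_(0 <= i < N) sigma N i ^+ r) / N%:R).
apply: (@eq_cvgn _ (fun N =>
  ntr (diag_array sigma N ^+ r *m tridiag N (c ^~ w) ^+ q) - S N + S N)).
  by move=> N; rewrite subrK.
by apply: cvgD; [exact: h|apply: cvgM; [exact: cvg_cst|exact: s]].
Qed.

Let K := Num.max C (2 * M).

Let K_ge0 : 0 <= K. Proof. by rewrite le_max C_ge0. Qed.

Let row_diag N : row_sum_le (diag_array sigma N) K.
Proof.
apply: (@row_sum_leW _ _ _ C); first by rewrite le_max lexx.
by apply: row_sum_le_diag_array => k; exact: sigma_le.
Qed.

Let row_tridiag N w : row_sum_le (tridiag N (c ^~ w)) K.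
Proof.
apply: (@row_sum_leW _ _ _ (2 * M)); first by rewrite le_max lexx orbT.
by apply: row_sum_le_tridiag => k; exact: clipped_le.
Qed.

Lemma word_trace_cvg s : \forall w \ae P,
  ntr (word (diag_array sigma N) (tridiag N (c ^~ w)) s) @[N --> \oo]
  --> moment (count_mem ord0 s) mu_T * moment (count (predC1 ord0) s) mu_b.
Proof.
apply: filterS (trace_cvg (count_mem ord0 s) (count (predC1 ord0) s)) => w h.
have [a a0 sort] := trace_word_sort s K_ge0.
pose t N := (\sum_(0 <= k < N.-1) `|sigma N k - sigma N k.+1|) / N%:R.
have t0 : (a * (2 * M)) * t N @[N --> \oo] --> (0 : R).
  rewrite -[X in _ --> X](mulr0 (a * (2 * M))); apply: cvgM; first exact: cvg_cst.
  exact: (array_increments_cvg0 sigma_le sigma_cvg).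
pose D N := ntr (word (diag_array sigma N) (tridiag N (c ^~ w)) s) -
  ntr (diag_array sigma N ^+ count_mem ord0 s *m
       tridiag N (c ^~ w) ^+ count (predC1 ord0) s).
have D0 : D N @[N --> \oo] --> (0 : R).
  apply: norm_cvg0; apply: (@squeeze_cvgr _ _ _ _ (fun=> 0) (fun N => a * (2 * M) * t N)).
  - apply: nearW => N; rewrite normr_ge0/= /D /ntr -mulrBr normrM normfV normr_nat.
    rewrite [leLHS]mulrC /t (mulrA (a * (2 * M))); apply: ler_wpM2r; first by rewrite invr_ge0.
    have := sort N (diag_array sigma N) (tridiag N (c ^~ w)) 1 1 ler01
      (@row_diag N) (@row_tridiag N w) (@row_sum_le1 R N).
    rewrite !mul1r mulr1 -mulmxE => /le_trans; apply.
    rewrite -mulrA ler_wpM2l//.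
    by apply: abs_sum_commutator_le => k; exact: clipped_le.
  - exact: cvg_cst.
  - exact: t0.
rewrite -[X in _ --> X]add0r.
apply: (@eq_cvgn _ (fun N => D N +
  ntr (diag_array sigma N ^+ count_mem ord0 s *m
       tridiag N (c ^~ w) ^+ count (predC1 ord0) s))).
  by move=> N; rewrite /D subrK.
by apply: cvgD; [exact: D0|exact: h].
Qed.

(** Uniform in [N] and in the sample point: this is the dominating constant for convergence in
    mean. *)
Lemma word_trace_le N w s :
  `|ntr (word (diag_array sigma N) (tridiag N (c ^~ w)) s)| <= K ^+ size s.
Proof.
have h := row_sum_le_word s K_ge0 (@row_diag N) (@row_tridiag N w).
have Ks : 0 <= K ^+ size s by exact: exprn_ge0.
rewrite /ntr normrM normfV normr_nat.
have [->|N0] := eqVneq N 0%N; first by rewrite invr0 mul0r.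
rewrite mulrC ler_pdivrMr ?ltr0n ?lt0n// (le_trans (ler_norm_sum _ _ _))//.
rewrite (@le_trans _ _ (\sum_(i < N) K ^+ size s))//.
  by apply: ler_sum => i _; exact: row_sum_le_entry.
by rewrite sumr_const card_ord mulr_natr.
Qed.

(** Stated for any measurable sequence because it serves both for [b] and for its truncation. *)
Lemma measurable_word_trace N s (e : nat -> Omega -> R) :
  (forall k, measurable_fun setT (e k)) ->
  measurable_fun setT
    (fun w => ntr (word (diag_array sigma N) (tridiag N (e ^~ w)) s)).
Proof.
move=> me.
have mw : forall i j, measurable_fun setT
    (fun w => word (diag_array sigma N) (tridiag N (e ^~ w)) s i j).
  rewrite /word; elim: s => [|l s IHs] i j.
    by under eq_fun do rewrite big_nil; exact: measurable_cst.
  under eq_fun do rewrite big_cons mxE.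
  apply: measurable_sum => k; apply: measurable_funM => //.
  case: (l == ord0); first exact: measurable_cst.
  under eq_fun do rewrite mxE.
  case: (nat_of_ord k == i.+1); first exact: me.
  by case: (nat_of_ord i == k.+1); [exact: me|exact: measurable_cst].
apply: measurable_funM => //; exact: measurable_sum.
Qed.

Lemma mean_word_trace_cvg s :
  \int[P]_w ntr (word (diag_array sigma N) (tridiag N (c ^~ w)) s) @[N --> \oo]
  --> moment (count_mem ord0 s) mu_T * moment (count (predC1 ord0) s) mu_b.
Proof.
apply: (@mean_cvg_of_ae _ _ _ P _ _ (K ^+ size s)).
- by move=> N; apply: measurable_word_trace => k; exact: measurable_clipped.
- by move=> N w; exact: word_trace_le.
- exact: word_trace_cvg.
Qed.

End word_traces.

Local Open Scope complex_scope.

(** * From words to polynomials with complex coefficients *)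

Section noncommutative_evaluation.
Context (R : realType).

Lemma map_word N (A B : 'M[R]_N) s :
  \prod_(i <- s) (if i == ord0 then map_mx (real_complex R) A
                  else map_mx (real_complex R) B) =
  map_mx (real_complex R) (word A B s).
Proof.
rewrite /word; elim: s => [|i s IHs]; first by rewrite !big_nil map_mx1.
by rewrite !big_cons map_mxM IHs; case: ifP.
Qed.

Lemma trace_scalar_map N (z : R[i]) (A : 'M[R]_N) :
  N%:R^-1 * \tr (z%:M *m map_mx (real_complex R) A) =
  z * (N%:R^-1 * \tr A)%:C.
Proof.
rewrite mul_scalar_mx mxtraceZ trace_map_mx mulrCA.
by rewrite [in RHS]rmorphM/= fmorphV rmorph_nat.
Qed.

Lemma ntr_nc_eval_mx N (p : ncpoly R[i]) (A B : 'M[R]_N) :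
  ntr (nc_eval_mx p A B) =
  \sum_(m <- msupp p) p@_m * (ntr (word A B (fmonom_val m)))%:C.
Proof.
rewrite /ntr /nc_eval_mx /nc_eval raddf_sum mulr_sumr; apply: eq_bigr => m _.
rewrite map_word; exact: trace_scalar_map.
Qed.

Lemma nc_eval_scalarE (p : ncpoly R[i]) (t x : R) :
  nc_eval_scalar p t x =
  \sum_(m <- msupp p) p@_m *
    (t ^+ count_mem ord0 (fmonom_val m) *
     x ^+ count (predC1 ord0) (fmonom_val m))%:C.
Proof.
rewrite /nc_eval_scalar /nc_eval; apply: eq_bigr => m _; congr (_ * _).
elim: (fmonom_val m) => [|i s IHs]; first by rewrite big_nil /= mul1r.
rewrite big_cons IHs /=; case: eqP => _ /=.
  by rewrite add1n exprS -mulrA [RHS]rmorphM.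
by rewrite add1n exprS mulrCA [RHS]rmorphM.
Qed.

End noncommutative_evaluation.

Section complex_combinations.
Context (R : realType).

Lemma cvgC_real (u : nat -> R) (l : R) : u n @[n --> \oo] --> l ->
  cvgC (fun n => (u n)%:C) l%:C.
Proof.
move=> /cvgrPdist_lt ul; apply/cvgrPdist_lt => e.
(* A positive element of [R[i]] is real, so the tolerance reduces to its real part. *)
rewrite ltcE => /andP[/eqP /= e0 eg0]; have := ul _ eg0; apply: filterS => n /= h.
have E : `|(l%:C - (u n)%:C : R[i])| = `|l - u n|%:C.
  by rewrite -rmorphB normc_def /= expr0n/= addr0 sqrtr_sqr.
by rewrite -[X in X < _]/(`|(l%:C - (u n)%:C : R[i])|) E ltcE /= e0 eqxx.
Qed.

Lemma cvgC_comb (I : Type) (s : seq I) (a : I -> R[i]) (u : I -> nat -> R)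
    (l : I -> R) : (forall i, u i n @[n --> \oo] --> l i) ->
  cvgC (fun n => \sum_(i <- s) a i * (u i n)%:C) (\sum_(i <- s) a i * (l i)%:C).
Proof.
move=> ul; apply: (@cvgn_sum R[i] R[i]^o) => i.
by apply: cvgM; [exact: cvg_cst|exact: cvgC_real].
Qed.

Context (d : measure_display) (Omega : measurableType d)
  (P : probability Omega R).

(** [f] holds the original variables, possibly unbounded on a null set; [g] holds their truncations,
    for which linearity of the mean is available. As the [f i] are real, real and imaginary parts
    act on the coefficients alone. *)
Lemma expectationC_comb (I : Type) (s : seq I) (a : I -> R[i])
    (f g : I -> Omega -> R) :
  (forall i, measurable_fun setT (f i)) -> (forall i, bounded_mfun (g i)) ->
  (\forall w \ae P, forall i, f i w = g i w) ->
  expectationC P (fun w => \sum_(i <- s) a i * (f i w)%:C) =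
  \sum_(i <- s) a i * (\int[P]_w g i w)%:C.
Proof.
move=> mf bg fg.
have mean (h : I -> R) :
    fine 'E_P[fun w => \sum_(i <- s) h i * f i w] = \sum_(i <- s) h i * \int[P]_w g i w.
  have bh i : bounded_mfun (fun w => h i * g i w).
    by apply: bounded_mfunM => //; exact: bounded_mfun_cst.
  transitivity (\int[P]_w \sum_(i <- s) h i * g i w).
    rewrite unlock; apply: Rintegral_ae_eq.
    - apply: measurable_sum => i; apply: measurable_funM => //.
    - by have [] := bounded_mfun_sum s bh.
    - by apply: filterS fg => w fgw; apply: eq_bigr => i _; rewrite fgw.
  by rewrite mean_sum//; apply: eq_bigr => i _; rewrite meanZ.
have ReE (z : R[i]) (x : R) : complex.Re (z * x%:C) = complex.Re z * x.
  by case: z => zr zi /=; rewrite mulr0 subr0.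
have ImE (z : R[i]) (x : R) : complex.Im (z * x%:C) = complex.Im z * x.
  by case: z => zr zi /=; rewrite mulr0 add0r.
rewrite /expectationC.
have -> : (fun w => complex.Re (\sum_(i <- s) a i * (f i w)%:C)) =
    (fun w => \sum_(i <- s) complex.Re (a i) * f i w).
  by apply/funext => w; rewrite raddf_sum; apply: eq_bigr => i _; rewrite /= ReE.
have -> : (fun w => complex.Im (\sum_(i <- s) a i * (f i w)%:C)) =
    (fun w => \sum_(i <- s) complex.Im (a i) * f i w).
  by apply/funext => w; rewrite raddf_sum; apply: eq_bigr => i _; rewrite /= ImE.
rewrite !mean; apply/eqP; rewrite eq_complex /= !raddf_sum/=.
by apply/andP; split; apply/eqP; apply: eq_bigr => i _; rewrite /= ?ReE ?ImE.
Qed.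

End complex_combinations.

(** * Mixed moments of the independent pair [T], [X] *)

Section independent_moments.
Context (R : realType) (d : measure_display) (Omega : measurableType d)
  (Q : probability Omega R).

(** The superlevel criterion is applied once to each factor, which leaves two events, one for [T]
    and one for [X]. *)
Lemma mean_independent_pair (T X : {RV Q >-> R}) (f g : R -> R) :
  independent_pair T X -> bounded_mfun f -> bounded_mfun g ->
  \int[Q]_w (f (T w) * g (X w)) = \int[Q]_w f (T w) * \int[Q]_w g (X w).
Proof.
move=> TX bf bg.
have bc (h : R -> R) (Y : {RV Q >-> R}) : bounded_mfun h ->
    bounded_mfun (fun w => h (Y w)).
  move=> [mh [K hK]]; split; first exact: measurableT_comp.
  by exists K => w.
have lev (h : R -> R) (t : R) : bounded_mfun h -> measurable [set x | t <= h x].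
  move=> [mh _]; have := mh measurableT `[t, +oo[%classic; rewrite setTI.
  have -> : h @^-1` `[t, +oo[ = [set x | t <= h x].
    by apply/seteqP; split => x /=; rewrite in_itv/= andbT.
  by apply.
have pre (A : set R) (Y : {RV Q >-> R}) : measurable A -> measurable (Y @^-1` A).
  by move=> mA; rewrite -[_ @^-1` _]setTI; exact: measurable_funP.
have levE (h : R -> R) (Y : {RV Q >-> R}) t w :
    (t <= h (Y w))%R%:R = \1_(Y @^-1` [set x | t <= h x]) w :> R.
  rewrite indicE; congr (nat_of_bool _)%:R.
  by apply/idP/idP => [?|/set_mem//]; exact/mem_set.
have bl (h : R -> R) (Y : {RV Q >-> R}) t : bounded_mfun h ->
    bounded_mfun (fun w => (t <= h (Y w))%R%:R : R).
  move=> bh; rewrite (funext (levE h Y t)); apply: bounded_mfun_indic.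
  by apply: pre; exact: lev.
apply: mean_prod_of_superlevels; [exact: bc|exact: bc|move=> t].
under eq_Rintegral do rewrite mulrC; rewrite [RHS]mulrC.
apply: mean_prod_of_superlevels; [exact: bc|exact: bl|move=> u].
have mA := pre _ X (lev g u bg); have mB := pre _ T (lev f t bf).
transitivity (\int[Q]_w (\1_(T @^-1` [set x | t <= f x] `&`
    X @^-1` [set x | u <= g x]) w : R)).
  by apply: eq_Rintegral => w _; rewrite !levE indicI/= mulrC.
rewrite mean_indic; last exact: measurableI.
rewrite [X in fine X](TX _ _ (lev f t bf) (lev g u bg)).
rewrite fineM ?fin_num_measure// mulrC.
by congr (_ * _); rewrite -mean_indic//; apply: eq_Rintegral => w _; rewrite levE.
Qed.

End independent_moments.

(** Words in two letters form a countable type, so a single null set serves for all of them. *)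
Lemma ae_forall_countable (R : realType) (d : measure_display)
    (Omega : measurableType d) (P : probability Omega R) (I : countType)
    (S : I -> Omega -> Prop) :
  (forall i, \forall w \ae P, S i w) -> \forall w \ae P, forall i, S i w.
Proof.
move=> PS.
have : \forall w \ae P, forall n : nat, if choice.unpickle n is Some i then S i w else True.
  apply: ae_foralln => n; case: (choice.unpickle n) => [i|]; first exact: PS.
  exact: aeW.
by apply: filterS => w h i; have := h (choice.pickle i); rewrite choice.pickleK.
Qed.

Section pushed_laws.
Context (R : realType) (d : measure_display) (Omega : measurableType d)
  (Q : probability Omega R) (T : {RV Q >-> R}) (mu : probability R R) (C : R).
Hypothesis T_law : has_law T mu.

Lemma ae_has_law (S : R -> Prop) :
  (\forall y \ae mu, S y) -> \forall w \ae Q, S (T w).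
Proof.
move=> [A [mA A0 SA]]; exists (T @^-1` A); split.
- by rewrite -[_ @^-1` _]setTI; exact: measurable_funP.
- by rewrite -[LHS]/(distribution Q T A) T_law.
- by move=> w Sw; exact: (SA (T w)).
Qed.

(** Expresses the moments of [mu] through a bounded variable, to which the product rule for
    independent pairs applies. *)
Lemma mean_clip_power r : 0 <= C -> (\forall y \ae mu, clip C y = y) ->
  \int[Q]_w (clip C (T w) ^+ r) = moment r mu.
Proof.
move=> C0 clipC.
have mc : measurable_fun setT (fun y => clip C y ^+ r).
  by apply: measurable_funX; exact: measurable_clip.
rewrite -(mean_law T_law (f := fun y => clip C y ^+ r)).
  by apply: Rintegral_ae_eq => //; apply: filterS clipC => y ->.
by apply: bounded_mfunX; split; [exact: measurable_clip|exists C => y; exact: norm_clip_le].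
Qed.

End pushed_laws.

Theorem theorem4p1 (R : realType)
    (d : measure_display) (Omega : measurableType d) (P : probability Omega R)
    (b : nat -> {RV P >-> R})
    (sigma : nat -> nat -> R)
    (mu_T mu_b : probability R R)
    (d' : measure_display) (Omega' : measurableType d')
    (Q : probability Omega' R) (T X : {RV Q >-> R})
    (b_iid : iid b)
    (b_bounded : bounded_support (b 0%N))
    (sigma_bounded :
      exists C : R, forall N k : nat, (k < N)%N -> `|sigma N k| <= C)
    (mu_b_limit : tridiag_limit_law b mu_b)
    (T_law : has_law T mu_T)
    (X_law : has_law X mu_b)
    (TX_indep : independent_pair T X)
    (sigma_cvg :
      weak_cvg2
        (fun N => empirical R N.-1 (fun k => (sigma N k, sigma N k.+1)))
        (joint_law T T)) :
  (forall p : ncpoly R[i],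
     cvgC (fun N => expectationC P (fun w =>
             ntr (nc_eval_mx p (diag_array sigma N)
                    (tridiag N (fun k => b k w)))))
          (expectationC Q (fun w => nc_eval_scalar p (T w) (X w))) /\
     (\forall w \ae P,
        cvgC (fun N => ntr (nc_eval_mx p (diag_array sigma N)
                              (tridiag N (fun k => b k w))))
             (expectationC Q (fun w' => nc_eval_scalar p (T w') (X w'))))) /\
  (forall r q : nat,
     \forall w \ae P,
       ntr (diag_array sigma N ^+ r *m tridiag N (fun k => b k w) ^+ q)
         @[N --> \oo] --> moment r mu_T * moment q mu_b).
Proof.
have [M bM] := b_bounded; have [C sC] := sigma_bounded.
(* For negative [M] the interval [[- M, M]] would be empty and have mass 0, not 1. *)
have M0 : 0 <= M.
  rewrite leNgt; apply/negP => M0; move: bM; rewrite set_itv_ge.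
    by move=> h; have := esym h; rewrite measure0 => -[] /eqP; rewrite oner_eq0.
  by rewrite bnd_simp -ltNge; lra.
have C0 : 0 <= C by rewrite (le_trans _ (sC 1 0 _)).
have M20 : 0 <= 2 * M by rewrite mulr_ge0.
have [_ idb] := b_iid; have cb := clipped_ae idb bM.
have cbE w : (forall k, clipped b M k w = b k w) ->
    (fun k => b k w) = (clipped b M) ^~ w.
  by move=> h; apply/funext => k; rewrite h.
split => [p|r q]; last first.
  have h := trace_cvg M0 b_iid bM sC mu_b_limit T_law sigma_cvg r q.
  by apply: filterS2 cb h => w /cbE ->.
have clipT := array_limit_clip T_law sC sigma_cvg.
have clipX := mu_b_clip M0 b_iid bM mu_b_limit.
(* The right-hand side is computed word by word: [T] and [X] agree almost surely with their
   truncations at [C] and [2 * M], and independence splits each mixed moment. *)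
have -> : expectationC Q (fun w => nc_eval_scalar p (T w) (X w)) =
    \sum_(m <- msupp p) p@_m *
      (moment (count_mem ord0 (fmonom_val m)) mu_T *
       moment (count (predC1 ord0) (fmonom_val m)) mu_b)%:C.
  rewrite (_ : (fun w => _) = fun w => \sum_(m <- msupp p) p@_m *
    (T w ^+ count_mem ord0 (fmonom_val m) *
     X w ^+ count (predC1 ord0) (fmonom_val m))%:C); last first.
    by apply/funext => w; exact: nc_eval_scalarE.
  have bclip (K : R) n : 0 <= K -> bounded_mfun (fun y : R => clip K y ^+ n).
    move=> K0; apply: bounded_mfunX; split; first exact: measurable_clip.
    by exists K => y; exact: norm_clip_le.
  rewrite (@expectationC_comb _ _ _ Q _ (msupp p) (fun m => p@_m)
    (fun m w => T w ^+ count_mem ord0 (fmonom_val m) *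
                X w ^+ count (predC1 ord0) (fmonom_val m))
    (fun m w => clip C (T w) ^+ count_mem ord0 (fmonom_val m) *
                clip (2 * M) (X w) ^+ count (predC1 ord0) (fmonom_val m))).
  - apply: eq_bigr => m _; congr (_ * _%:C).
    rewrite (mean_independent_pair TX_indep (bclip C _ C0) (bclip (2 * M) _ M20)).
    by rewrite (mean_clip_power T_law)// (mean_clip_power X_law).
  - by move=> m; apply: measurable_funM; exact: measurable_funX.
  - move=> m; apply: bounded_mfunM; apply: bounded_mfunX; split.
    + by apply: measurableT_comp => //; exact: measurable_clip.
    + by exists C => w; exact: norm_clip_le.
    + by apply: measurableT_comp => //; exact: measurable_clip.
    + by exists (2 * M) => w; exact: norm_clip_le.
  - by apply: filterS2 (ae_has_law T_law clipT) (ae_has_law X_law clipX) => w -> ->.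
split.
(* The expectation is unchanged by truncating the [b k], and is a finite combination of means of
   word traces. *)
- apply: (@eq_cvgn R[i]^o (fun N => \sum_(m <- msupp p) p@_m *
    (\int[P]_w ntr (word (diag_array sigma N) (tridiag N ((clipped b M) ^~ w))
                   (fmonom_val m)))%:C)).
    move=> N; rewrite (_ : (fun w => _) = fun w => \sum_(m <- msupp p) p@_m *
      (ntr (word (diag_array sigma N) (tridiag N (fun k => b k w)) (fmonom_val m)))%:C);
      last by apply/funext => w; exact: ntr_nc_eval_mx.
    apply: expectationC_comb.
    + by move=> m; exact: measurable_word_trace.
    + move=> m; split.
        by apply: measurable_word_trace => k; exact: measurable_clipped.
      exists (Num.max C (2 * M) ^+ size (fmonom_val m)) => w.
      exact: (word_trace_le b M0 sC).
    + by apply: filterS cb => w /cbE h m; rewrite h.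
  apply: cvgC_comb => m.
  exact: (mean_word_trace_cvg M0 b_iid bM sC mu_b_limit T_law sigma_cvg).
- have h := ae_forall_countable
    (word_trace_cvg M0 b_iid bM sC mu_b_limit T_law sigma_cvg).
  apply: filterS2 cb h => w /cbE -> h.
  apply: (@eq_cvgn R[i]^o (fun N => \sum_(m <- msupp p) p@_m *
    (ntr (word (diag_array sigma N) (tridiag N ((clipped b M) ^~ w))
         (fmonom_val m)))%:C)).
    by move=> N; exact: ntr_nc_eval_mx.
  by apply: cvgC_comb => m; exact: h.
Qed.
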